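(* Let $n,\delta$ be positive integers. For a bit-string $B$ of length $n$, there is a data structure that uses $n/\delta+o(n/\delta)$ bits and supports ${\textsf{drankA}}_1$ and ${\textsf{selectA}}_1$ queries on $B$ with additive error $\delta$ in constant time. If $B$ contains $m$ 1's, the data structure can use $\mathcal{B}(n/\delta,m/\delta)+o(n/\delta)$ bits and still supports these queries in $O(1)$ time.
   Context: Model: word-RAM with word size $\Theta(\lg n)$. For a bit-string $B[1\dots n]$ and $b\in\{0,1\}$: ${\textsf{rank}}_b(i,B)$ is the number of $b$'s in $B[1\dots i]$, and ${\textsf{select}}_b(i,B)$ is the position of the $i$-th $b$ in $B$. ${\textsf{drankA}}_b(i,B,\delta)$ returns any value $r$ with ${\textsf{rank}}_b(i,B)-\delta<r\le{\textsf{rank}}_b(i,B)$; ${\textsf{selectA}}_b(i,B,\delta)$ returns any position $p$ with ${\textsf{select}}_b(i-\delta,B)<p\le{\textsf{select}}_b(i,B)$. $\mathcal{B}(n,m)=\lg\lceil\binom{n}{m}\rceil$. *)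

(* Defs.v *)
From mathcomp Require Import all_boot all_order all_algebra.
From mathcomp Require Import all_classical all_reals all_analysis.

Set Implicit Arguments.
Unset Strict Implicit.
Unset Printing Implicit Defensive.

Import Order.TTheory GRing.Theory Num.Theory.
Import numFieldNormedType.Exports.

Local Open Scope nat_scope.

(* Positions in a bit-string are numbered from 1. *)

Definition rank (b : bool) (i : nat) (B : bitseq) : nat :=
  count_mem b (take i B).

Definition positions (b : bool) (B : bitseq) : seq nat :=
  [seq p <- iota 1 (size B) | nth (~~ b) B p.-1 == b].

(* [select b 0 B = 0]; together with the truncated subtraction [i - delta] this
   is the usual convention select_b(k, B) = 0 for k <= 0. *)
Definition select (b : bool) (i : nat) (B : bitseq) : nat :=
  nth 0 (0 :: positions b B) i.

(* rank - delta < r is written additively since subtraction on nat truncates. *)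
Definition is_drankA (b : bool) (i : nat) (B : bitseq) (delta r : nat) : Prop :=
  rank b i B < r + delta /\ r <= rank b i B.

Definition is_selectA (b : bool) (i : nat) (B : bitseq) (delta p : nat) : Prop :=
  select b (i - delta) B < p /\ p <= select b i B.

(* The word-RAM.  A word is a natural number below 2 ^ w.  A data structure is a
   bit-string packed, w bits per word, into a read-only memory; all cells and
   bits beyond its end are 0, so that its length conveys no extra information.
   Programs work on a register file and use one time unit per instruction. *)

Inductive binop :=
  | OpAdd | OpSub | OpMul | OpDiv | OpMod
  | OpAnd | OpOr | OpXor | OpShl | OpShr | OpLt | OpEq.

Definition eval_binop (w : nat) (o : binop) (x y : nat) : nat :=
  (match o with
   | OpAdd => x + y
   | OpSub => x + (2 ^ w - y)
   | OpMul => x * y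
   | OpDiv => x %/ y
   | OpMod => x %% y
   | OpAnd => Nat.land x y
   | OpOr => Nat.lor x y
   | OpXor => Nat.lxor x y
   | OpShl => x * 2 ^ y
   | OpShr => x %/ 2 ^ y
   | OpLt => nat_of_bool (x < y)
   | OpEq => nat_of_bool (x == y)
   end) %% 2 ^ w.

Inductive instr :=
  | Const of nat & nat
  | Binop of binop & nat & nat & nat
  | Fetch of nat & nat
  | Jz of nat & nat.

Definition program := seq instr.

Record state := State { pc : nat; reg : nat -> nat }.

Definition upd (r : nat -> nat) (d v : nat) : nat -> nat :=
  fun k => if k == d then v else r k.

Definition memory (w : nat) (D : bitseq) (a : nat) : nat :=
  \sum_(k < w) nth false D (a * w + k) * 2 ^ k.

(* The machine halts by leaving the program. *)
Definition step (w : nat) (D : bitseq) (P : program) (s : state) : state :=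
  match onth P (pc s) with
  | None => s
  | Some (Const d k) => State (pc s).+1 (upd (reg s) d (k %% 2 ^ w))
  | Some (Binop o d a b) =>
      State (pc s).+1 (upd (reg s) d (eval_binop w o (reg s a) (reg s b)))
  | Some (Fetch d a) =>
      State (pc s).+1 (upd (reg s) d (memory w D (reg s a)))
  | Some (Jz a l) =>
      State (if reg s a == 0 then l else (pc s).+1) (reg s)
  end.

Definition initial (w : nat) (args : seq nat) : state :=
  State 0 (fun k => nth 0 args k %% 2 ^ w).

(* Within T steps, P halts on the given arguments with r_0 satisfying Q. *)
Definition computes (w : nat) (D : bitseq) (P : program) (T : nat)
    (args : seq nat) (Q : nat -> Prop) : Prop :=
  let s := iter T (step w D P) (initial w args) in
  size P <= pc s /\ Q (reg s 0).

(* The query programs receive the query argument i and the global parameters n,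
   delta and w, but not the number of 1's.  As i, n and w are below 2 ^ w, the
   reduction in [initial] only affects delta, and only when delta > n. *)
Definition supports (w : nat) (prank pselect : program) (T : nat)
    (n delta : nat) (B : n.-tuple bool) (D : bitseq) : Prop :=
  (forall i, 1 <= i <= n ->
     computes w D prank T [:: i; n; delta; w] (is_drankA true i B delta)) /\
  (forall i, 1 <= i <= count_mem true B ->
     computes w D pselect T [:: i; n; delta; w] (is_selectA true i B delta)).

(* k is the floor or the ceiling of a / d. *)
Definition rounding (a d k : nat) : Prop :=
  k = a %/ d \/ k = (a + d.-1) %/ d.

Local Open Scope ring_scope.

Definition lg {R : realType} (x : R) : R := ln x / ln 2.

(* lg of the binomial coefficient; on natural arguments the coefficient is an
   integer and needs no rounding. *)
Definition binentropy {R : realType} (N M : nat) : R := lg ('C(N, M)%:R).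

(* Lets the Landau notation [f =o_ (pinfty_nbhs R) g] be used at +oo. *)
Canonical pinfty_filter_on (R : numFieldType) : filter_on R :=
  FilterType (pinfty_nbhs R) (@filter_filter _ _ proper_pinfty_nbhs).

(* Main.v *)
(** Cut [B] into cells of [delta] positions and let [c j] be the number of ones in the
    first [j] cells.  The string [V] whose bit [j] tells whether [c j %/ delta] increases
    over cell [j] has length [ceil (n / delta)] and [floor (m / delta)] ones.  Linear
    interpolation inside a cell turns an exact rank or select query on [V] into an
    answer with additive error below [delta] on [B].  Hence an indexable dictionary for
    [V] suffices: blocks of [l ~ lg |V|] bits are stored as indices into the list of
    [l]-bit strings of the same weight, located by two-level directories, and decoded by
    universal tables; select uses Clark's two levels of sparse and dense groups, a sparse
    group being stored in the slot of positions in which it starts.  All parameters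
    depend on [|V|], not on [n], so the directories take [o(|V|)] bits however small
    [|V|] is; the machine learns them from a self-delimiting header.  Lengths below a
    constant [n0] are handled by tabulating all ranks. *)
Require Import Defs.
From mathcomp Require Import all_boot all_order all_algebra.
From mathcomp Require Import all_classical all_reals all_analysis.
From mathcomp Require Import zify.
From Stdlib Require PeanoNat.
Import Order.TTheory GRing.Theory Num.Theory.
Import numFieldNormedType.Exports.
Set Implicit Arguments.
Unset Strict Implicit.
Unset Printing Implicit Defensive.
Local Open Scope nat_scope.

(** * Straight-line expressions on the word-RAM *)

(** The obstacle is uniformity. One fixed pair of programs must serve every [n] and [delta], yet the
    redundancy is measured against [n / delta], which may be tiny compared with [n] and with the
    word size; hence the machine cannot derive the block size from [w], and it has no logarithm
    either. Queries are written as branch-free expressions, so that constant time is simply the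
    length of the compiled program. The price is that both sides of every choice are evaluated, the
    wrong one possibly on meaningless data; evaluation is therefore described modulo [2 ^ w], and a
    wrong side is cancelled by a factor 0. Space is estimated multiplicatively on [nat]: the powers
    of two of the block code lengths are compared with a product of binomials, which one binomial
    bounds. Logarithms appear only at the very end. *)

Inductive expr :=
  | Arg of 'I_4
  | Cst of nat
  | Bin of binop & expr & expr
  | Peek of expr.

Section Expressions.
Variables (w : nat) (D : bitseq) (a : nat -> nat).

Fixpoint eval (e : expr) : nat :=
  match e with
  | Arg k => a k
  | Cst c => c %% 2 ^ w
  | Bin o x y => eval_binop w o (eval x) (eval y)
  | Peek x => memory w D (eval x)
  end.

(* Registers below [d] are preserved, so the arguments stay available. *)
Fixpoint compile (e : expr) (d : nat) : program :=
  match e with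
  | Arg k => [:: Binop OpOr d k k]
  | Cst c => [:: Const d c]
  | Bin o x y => compile x d ++ compile y d.+1 ++ [:: Binop o d d d.+1]
  | Peek x => compile x d ++ [:: Fetch d d]
  end.

Lemma onth_prefix (T : Type) (pre post : seq T) x :
  onth (pre ++ x :: post) (size pre) = Some x.
Proof. by elim: pre. Qed.

(** Registers serve as a stack: the right operand is computed from [d.+1] on, so the left one
    survives in [d]. The contexts [pre] and [post] are arbitrary because the induction places
    subprograms at other absolute positions. *)
Lemma compile_correct e d (pre post : program) r :
    (forall k, a k < 2 ^ w) -> 4 <= d -> (forall k, k < 4 -> r k = a k) ->
  exists r', [/\ iter (size (compile e d)) (step w D (pre ++ compile e d ++ post))
                   (State (size pre) r)
                 = State (size pre + size (compile e d)) r',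
                 r' d = eval e & forall k, k < d -> r' k = r k].
Proof.
move=> a_lt.
elim: e d pre post r => [k|c|o x IHx y IHy|x IHx] d pre post r d4 ra /=.
- exists (upd r d (a k)); split; last 2 first.
  + by rewrite /upd eqxx.
  + by move=> j jd; rewrite /upd ltn_eqF.
  rewrite /step /= onth_prefix /= addn1 ra //.
  by rewrite /eval_binop (PeanoNat.Nat.lor_diag : forall x, Nat.lor x x = x) modn_small.
- exists (upd r d (c %% 2 ^ w)); split; last 2 first.
  + by rewrite /upd eqxx.
  + by move=> j jd; rewrite /upd ltn_eqF.
  by rewrite /step /= onth_prefix /= addn1.
- have [r1 [E1 R1 K1]] := IHx d pre (compile y d.+1 ++ [:: Binop o d d d.+1] ++ post) r d4 ra.
  have ra1 k : k < 4 -> r1 k = a k by move=> k4; rewrite K1 ?ra //; lia.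
  have [r2 [E2 R2 K2]] := IHy d.+1 (pre ++ compile x d) ([:: Binop o d d d.+1] ++ post) r1
    (leqW d4) ra1.
  exists (upd r2 d (eval_binop w o (r2 d) (r2 d.+1))); split; last 2 first.
  + by rewrite /upd eqxx R2 (K2 d) // R1.
  + by move=> j jd; rewrite /upd ltn_eqF // K2 ?K1 //; lia.
  rewrite -!catA in E1 E2 *.
  rewrite !size_cat /= addn1 addnS iterS [size (compile x d) + _]addnC iterD E1.
  rewrite -size_cat E2 /step /=.
  rewrite !catA -size_cat onth_prefix /= !size_cat; congr State; lia.
- have [r1 [E1 R1 K1]] := IHx d pre ([:: Fetch d d] ++ post) r d4 ra.
  exists (upd r1 d (memory w D (r1 d))); split; last 2 first.
  + by rewrite /upd eqxx R1.
  + by move=> j jd; rewrite /upd ltn_eqF // K1.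
  rewrite -!catA size_cat /= addn1 iterS E1 /step /=.
  by rewrite catA -size_cat onth_prefix /= size_cat addnS.
Qed.

End Expressions.

(** For want of a move instruction, a register is copied by disjunction with itself. *)
Definition program_of (e : expr) : program := compile e 4 ++ [:: Binop OpOr 0 4 4].

Lemma memory_lt w D x : memory w D x < 2 ^ w.
Proof.
rewrite /memory; elim: w (x * w) => [|v IHv] b; first by rewrite big_ord0.
rewrite big_ord_recr /= expnS mul2n -addnn.
by rewrite -addSn leq_add ?IHv //; case: nth; rewrite ?mul1n.
Qed.

Lemma eval_lt w D a e : (forall k, a k < 2 ^ w) -> eval w D a e < 2 ^ w.
Proof.
by move=> a_lt; case: e => [k|c|o x y|x] //=; rewrite ?memory_lt // ?/eval_binop ltn_pmod ?expn_gt0.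
Qed.

Definition regs w (args : seq nat) : nat -> nat := reg (initial w args).

Lemma regs_lt w args k : regs w args k < 2 ^ w.
Proof. by rewrite /regs /= ltn_pmod ?expn_gt0. Qed.

Lemma computes_program_of w D e args (Q : nat -> Prop) :
  Q (eval w D (regs w args) e) ->
  computes w D (program_of e) (size (program_of e)) args Q.
Proof.
move=> HQ; rewrite /computes /program_of.
have [r [E R _]] := @compile_correct w D (regs w args) e 4 [::] [:: Binop OpOr 0 4 4]
  (reg (initial w args)) (regs_lt w args) isT (fun k _ => erefl).
rewrite size_cat addn1 iterS.
have -> : initial w args = State (size (Nil instr)) (reg (initial w args)) by [].
rewrite E /step /= add0n onth_prefix /= /upd eqxx R /eval_binop.
rewrite (PeanoNat.Nat.lor_diag : forall x, Nat.lor x x = x).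
by rewrite modn_small // eval_lt //; apply: regs_lt.
Qed.

(** * Word arithmetic and unaligned reads *)

Notation add := (Bin OpAdd).
Notation sub := (Bin OpSub).
Notation mul := (Bin OpMul).
Notation dvn := (Bin OpDiv).
Notation mdn := (Bin OpMod).
Notation ltx := (Bin OpLt).
Notation eqx := (Bin OpEq).
Notation shl := (Bin OpShl).
Notation shr := (Bin OpShr).
Definition arg_i : expr := Arg (@Ordinal 4 0 isT).
Definition arg_n : expr := Arg (@Ordinal 4 1 isT).
Definition arg_d : expr := Arg (@Ordinal 4 2 isT).
Definition arg_w : expr := Arg (@Ordinal 4 3 isT).

Definition cond (c x y : expr) : expr := add (mul c x) (mul (sub (Cst 1) c) y).

(* The [l] bits at address [b + p], where the sum itself may exceed a word. *)
Definition read_word (b p : expr) : expr :=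
  add (add (dvn b arg_w) (dvn p arg_w)) (dvn (add (mdn b arg_w) (mdn p arg_w)) arg_w).
Definition read_shift (b p : expr) : expr :=
  mdn (add (mdn b arg_w) (mdn p arg_w)) arg_w.
Definition read (b p l : expr) : expr :=
  mdn (add (shr (Peek (read_word b p)) (read_shift b p))
           (shl (Peek (add (read_word b p) (Cst 1))) (sub arg_w (read_shift b p))))
      (shl (Cst 1) l).

Definition bits_val (D : bitseq) (p l : nat) : nat :=
  \sum_(k < l) nth false D (p + k) * 2 ^ k.

Lemma bits_valD D p l k :
  bits_val D p (l + k) = bits_val D p l + 2 ^ l * bits_val D (p + l) k.
Proof.
rewrite /bits_val big_split_ord /=; congr (_ + _).
rewrite big_distrr /=; apply: eq_bigr => i _.
by rewrite addnA expnD mulnCA.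
Qed.

Lemma bits_val_lt D p l : bits_val D p l < 2 ^ l.
Proof.
rewrite /bits_val; elim: l => [|l IHl]; first by rewrite big_ord0.
rewrite big_ord_recr /= expnS mul2n -addnn.
by rewrite -addSn leq_add ?IHl //; case: nth; rewrite ?mul1n.
Qed.

Lemma memoryE w D x : memory w D x = bits_val D (x * w) w.
Proof. by []. Qed.

Lemma bits_val_mod D p l k : k <= l -> bits_val D p l %% 2 ^ k = bits_val D p k.
Proof.
move=> kl; rewrite -(subnKC kl) bits_valD addnC mulnC modnMDl modn_small //.
exact: bits_val_lt.
Qed.

Lemma bits_val_div D p l k : k <= l -> bits_val D p l %/ 2 ^ k = bits_val D (p + k) (l - k).
Proof.
move=> kl; rewrite -{1}(subnKC kl) bits_valD addnC mulnC divnMDl ?expn_gt0 //.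
by rewrite divn_small ?addn0 // bits_val_lt.
Qed.

Lemma bits_val_unaligned w D x o : o <= w ->
  memory w D x %/ 2 ^ o + (memory w D x.+1 * 2 ^ (w - o)) %% 2 ^ w
  = bits_val D (x * w + o) w.
Proof.
move=> ow; rewrite !memoryE bits_val_div //.
have -> : 2 ^ w = 2 ^ o * 2 ^ (w - o) by rewrite -expnD subnKC.
rewrite -muln_modl bits_val_mod //.
have -> : x.+1 * w = x * w + o + (w - o) by rewrite mulSn; lia.
by rewrite [_ * 2 ^ _]mulnC -bits_valD subnK.
Qed.

(** * Evaluation modulo the word size *)

Section EvalRules.
Variables (w : nat) (D : bitseq) (a : nat -> nat).
Local Notation ev := (eval w D a).
Local Notation W := (2 ^ w).

Lemma eval_cst c : ev (Cst c) = c %% W. Proof. by []. Qed.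

(** An expression stands for an ideal number [X] known only modulo [W]. Sums, products and
    nonnegative differences may overflow midway; range conditions occur only where the residue does
    not determine the result. *)
Lemma eval_add x y X Y : ev x = X %% W -> ev y = Y %% W -> ev (add x y) = (X + Y) %% W.
Proof. by move=> /= -> ->; rewrite /eval_binop modnDm. Qed.

Lemma eval_mul x y X Y : ev x = X %% W -> ev y = Y %% W -> ev (mul x y) = (X * Y) %% W.
Proof. by move=> /= -> ->; rewrite /eval_binop modnMm. Qed.

Lemma eval_mul0 x y : ev x = 0 %% W -> ev (mul x y) = 0 %% W.
Proof. by move=> /= ->; rewrite /eval_binop mod0n mul0n mod0n. Qed.

Lemma eval_sub x y X Y : ev x = X %% W -> ev y = Y %% W -> Y <= X ->
  ev (sub x y) = (X - Y) %% W.
Proof.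
move=> /= -> -> YX; rewrite /eval_binop.
apply/eqP; rewrite -(eqn_modDr Y) subnK // -addnA modnDml -modnDmr.
have H : Y %% W <= W by rewrite ltnW // ltn_pmod ?expn_gt0.
rewrite {2}(divn_eq Y W) [_ * W + _]addnC addnA subnK // -[X in X + _ * _]mul1n -mulnDl.
by rewrite modnMl addn0.
Qed.

Lemma eval_neg x X : ev x = X %% W -> ev (sub (Cst 0) x) = (W - X %% W) %% W.
Proof. by move=> /= ->; rewrite /eval_binop mod0n add0n. Qed.

Lemma eval_div x y X Y : ev x = X %% W -> ev y = Y %% W -> X < W -> Y < W ->
  ev (dvn x y) = (X %/ Y) %% W.
Proof. by move=> /= -> -> XW YW; rewrite /eval_binop (modn_small XW) (modn_small YW). Qed.

Lemma eval_mod x y X Y : ev x = X %% W -> ev y = Y %% W -> X < W -> Y < W ->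
  ev (mdn x y) = (X %% Y) %% W.
Proof. by move=> /= -> -> XW YW; rewrite /eval_binop (modn_small XW) (modn_small YW). Qed.

Lemma eval_mod0 x y X : ev x = X %% W -> ev y = 0 -> ev (mdn x y) = X %% W.
Proof. by move=> /= -> ->; rewrite /eval_binop modn0 modn_mod. Qed.

Lemma eval_lt_op x y X Y : ev x = X %% W -> ev y = Y %% W -> X < W -> Y < W ->
  ev (ltx x y) = (X < Y) %% W.
Proof. by move=> /= -> -> XW YW; rewrite /eval_binop (modn_small XW) (modn_small YW). Qed.

Lemma eval_eq_op x y X Y : ev x = X %% W -> ev y = Y %% W -> X < W -> Y < W ->
  ev (eqx x y) = (X == Y) %% W.
Proof. by move=> /= -> -> XW YW; rewrite /eval_binop (modn_small XW) (modn_small YW). Qed.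

Lemma eval_shl x y X Y : ev x = X %% W -> ev y = Y %% W -> Y < W ->
  ev (shl x y) = (X * 2 ^ Y) %% W.
Proof. by move=> /= -> -> YW; rewrite /eval_binop (@modn_small Y) // modnMml. Qed.

Lemma eval_shr x y X Y : ev x = X %% W -> ev y = Y %% W -> X < W -> Y < W ->
  ev (shr x y) = (X %/ 2 ^ Y) %% W.
Proof. by move=> /= -> -> XW YW; rewrite /eval_binop (modn_small XW) (modn_small YW). Qed.

Lemma eval_fetch x X : ev x = X %% W -> X < W -> ev (Peek x) = memory w D X %% W.
Proof. by move=> /= -> XW; rewrite (modn_small XW) modn_small ?memory_lt. Qed.

(** The side not chosen is multiplied by 0, so nothing is required of its value. *)
Lemma eval_cond c x y (b : bool) X Y : ev c = b %% W ->
    (b -> ev x = X %% W) -> (~~ b -> ev y = Y %% W) ->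
  ev (cond c x y) = (if b then X else Y) %% W.
Proof.
move=> Ec Ex Ey.
have Ed : ev (sub (Cst 1) c) = (~~ b) %% W by rewrite (@eval_sub _ _ 1 b) //; case: (b).
rewrite /cond (eval_add (X := if b then X else 0) (Y := if b then 0 else Y)) //.
- by case: b {Ec Ex Ey Ed}; rewrite ?addn0.
- case: b Ec Ex {Ed Ey} => Ec Ex; last exact: eval_mul0.
  by rewrite (eval_mul Ec (Ex isT)) mul1n.
- case: b Ed Ey {Ec Ex} => Ed Ey; first exact: eval_mul0.
  by rewrite (eval_mul Ed (Ey isT)) mul1n.
Qed.

Hypotheses (aw : a 3 = w) (w4 : 4 <= w).

Lemma eval_arg_w : ev arg_w = w %% W.
Proof. by rewrite /= aw modn_small // ltn_expl. Qed.

Lemma eval_read b p l B P L : ev b = B %% W -> ev p = P %% W -> ev l = L %% W ->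
  B < W -> P < W -> L <= w -> ev (read b p l) = bits_val D (B + P) L %% W.
Proof.
move=> Eb Ep El BW PW Lw.
have wW : 4 * w <= W.
  by move: w4; case: (w) => [|[|[|[|v]]]] // _; rewrite !expnS; have := ltn_expl v (ltnSn 1); lia.
have w0 : 0 < w by lia.
have wlt : w < W by lia.
have Ew := eval_arg_w.
have mBP : B %% w + P %% w < W.
  have mB : B %% w < w by rewrite ltn_mod.
  have mP : P %% w < w by rewrite ltn_mod.
  by clear -mB mP wW w0; lia.
have Em := eval_add (eval_mod Eb Ew BW wlt) (eval_mod Ep Ew PW wlt).
pose o := (B %% w + P %% w) %% w.
have ow : o < w by rewrite ltn_mod.
have Es : ev (read_shift b p) = o %% W := eval_mod Em Ew mBP wlt.
pose x := B %/ w + P %/ w + (B %% w + P %% w) %/ w.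
have Ex : ev (read_word b p) = x %% W :=
  eval_add (eval_add (eval_div Eb Ew BW wlt) (eval_div Ep Ew PW wlt)) (eval_div Em Ew mBP wlt).
have Exw : x * w + o = B + P.
  rewrite [in RHS](divn_eq B w) [in RHS](divn_eq P w) addnACA -mulnDl.
  by rewrite (divn_eq (B %% w + _) w) addnA -mulnDl.
(* From [x * w <= B + P < 2 * W] and [w >= 4], [x] is below [W / 2]; so the second word is
   addressable too. *)
have xW : x.+1 < W by clear -Exw BW PW w4 wW; clearbody x; nia.
clearbody x o; clear mBP Em.
have oW : o < W := ltn_trans ow wlt.
have E1 := eval_fetch Ex (ltnW xW).
have E2 := eval_fetch (eval_add Ex (eval_cst 1)).
rewrite addn1 in E2; have {}E2 := E2 xW.
have E3 := eval_shr E1 Es (memory_lt _ _ _) oW.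
have E4 : ev (shl (Peek (add (read_word b p) (Cst 1))) (sub arg_w (read_shift b p)))
   = ((memory w D x.+1 * 2 ^ (w - o)) %% W) %% W.
  rewrite modn_mod; apply: (eval_shl E2 (eval_sub Ew Es (ltnW ow))).
  exact: leq_ltn_trans (leq_subr _ _) wlt.
have E5 := eval_add E3 E4; rewrite bits_val_unaligned ?(ltnW ow) // Exw in E5.
rewrite /read -(bits_val_mod _ _ Lw).
have E6 : ev (shl (Cst 1) l) = (1 * 2 ^ L) %% W.
  by apply: eval_shl => //; apply: leq_ltn_trans Lw wlt.
rewrite mul1n in E6; case: (ltngtP L w) Lw => // [Lw _|Lw _].
  by apply: (eval_mod E5 E6); rewrite ?bits_val_lt ?ltn_exp2l.
(* For [L = w] the modulus [2 ^ L] wraps to 0, and reduction modulo 0 is the identity, which keeps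
   the whole word as desired. *)
rewrite Lw modnn in E6; rewrite Lw bits_val_mod //; exact: eval_mod0 E5 E6.
Qed.
End EvalRules.

(** * Rank and select on Boolean functions *)

Definition rk (v : nat -> bool) (j : nat) : nat := \sum_(i < j) v i.

(* Ones are numbered from 0; the value is [N] if there are at most [k] ones below [N]. *)
Definition ps (N : nat) (v : nat -> bool) (k : nat) : nat :=
  find (fun j => k < rk v j.+1) (iota 0 N).

Lemma rk0 v : rk v 0 = 0. Proof. by rewrite /rk big_ord0. Qed.

Lemma rkS v j : rk v j.+1 = rk v j + v j. Proof. by rewrite /rk big_ord_recr. Qed.

Lemma rkD v j k : rk v (j + k) = rk v j + rk (fun i => v (j + i)) k.
Proof. by rewrite /rk big_split_ord. Qed.

Lemma eq_rk u v j : (forall k, k < j -> u k = v k) -> rk u j = rk v j.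
Proof. by move=> uv; apply: eq_bigr => i _; rewrite uv. Qed.

Lemma rk_le v j : rk v j <= j.
Proof. by elim: j => [|j IHj]; rewrite ?rk0 // rkS; case: (v j); lia. Qed.

Lemma leq_rk v i j : i <= j -> rk v i <= rk v j.
Proof. by move=> ij; rewrite -(subnKC ij) rkD leq_addr. Qed.

Lemma ps_le N v k : ps N v k <= N.
Proof. by rewrite /ps -{2}(size_iota 0 N) find_size. Qed.

(** The adjunction between select and rank, from which the comparisons of positions below are
    derived. *)
Lemma ps_lt N v k j : j <= N -> (ps N v k < j) = (k < rk v j).
Proof.
move=> jN; apply/idP/idP => [pj|].
  have hs : has (fun j => k < rk v j.+1) (iota 0 N).
    by rewrite has_find size_iota (leq_trans pj).
  have := nth_find 0 hs; rewrite -/(ps N v k) nth_iota ?(leq_trans pj) // add0n.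
  by move=> kp; apply: leq_trans kp (leq_rk _ _).
case: j jN => [|j] jN kj; first by rewrite rk0 in kj.
rewrite ltnS leqNgt; apply/negP => jp.
have := before_find 0 jp; rewrite nth_iota ?(leq_trans _ jN) // add0n kj; lia.
Qed.

Lemma rk_ps N v k : k < rk v N -> rk v (ps N v k) = k.
Proof.
move=> kN; have pN : ps N v k < N by rewrite ps_lt.
have h1 : k < rk v (ps N v k).+1 by rewrite -(@ps_lt N).
have h2 : (k < rk v (ps N v k)) = false by rewrite -(@ps_lt N) ?ltnn // ltnW.
by move: h1; rewrite rkS; case: (v _); lia.
Qed.

Lemma one_ps N v k : k < rk v N -> v (ps N v k).
Proof.
move=> kN; have pN : ps N v k < N by rewrite ps_lt.
have : k < rk v (ps N v k).+1 by rewrite -(@ps_lt N).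
by rewrite rkS rk_ps //; case: (v _) => //; rewrite addn0 ltnn.
Qed.

Lemma ps_unique N v k j : j < N -> rk v j = k -> v j -> ps N v k = j.
Proof.
move=> jN rj vj; apply/eqP; rewrite eqn_leq; apply/andP; split.
  by rewrite -ltnS ps_lt // rkS vj rj addn1.
by rewrite leqNgt ps_lt ?rj ?ltnn // ltnW.
Qed.

Lemma leq_ps N v k k' : k <= k' -> ps N v k <= ps N v k'.
Proof.
move=> kk; rewrite leqNgt ps_lt ?ps_le //; apply/negP => h.
have := ps_lt v k (ps_le N v k); rewrite ltnn => /esym/negbT/negP; apply.
exact: leq_ltn_trans kk h.
Qed.

Lemma ltn_ps N v k k' : k < k' -> k < rk v N -> ps N v k < ps N v k'.
Proof.
move=> kk kN; rewrite ps_lt ?ps_le //.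
case: (ltnP k' (rk v N)) => k'N; first by rewrite rk_ps.
have : ps N v k' = N; last by move->.
apply/eqP; rewrite eqn_leq ps_le leqNgt /=.
by apply/negP; rewrite ps_lt // ltnNge k'N.
Qed.

Lemma eq_ps N u v k : (forall j, j < N -> u j = v j) -> ps N u k = ps N v k.
Proof.
move=> uv; apply: eq_in_find => j; rewrite mem_iota add0n => /andP[_ jN].
by congr (_ < _); apply: eq_rk => i ij; apply: uv; apply: leq_trans ij jN.
Qed.

(* A group of [t] ones spanning at least [X] positions is the last one to start in
   its slot of [X] positions, hence it is determined by the slot. *)
Lemma sparse_group N v X t g : 0 < X -> 0 < t -> g * t < rk v N ->
    ps N v (g * t) + X <= ps N v (g.+1 * t) ->
  (rk v ((ps N v (g * t) %/ X).+1 * X)).-1 %/ t = g.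
Proof.
move=> X0 t0 gN sp; set p := ps N v (g * t) in sp *.
(* [P] is the end of the slot of [p]. The next group starts at or after [P], so
   [g * t < rk v P <= g.+1 * t]; the predecessor in the statement takes care of equality on the
   right. *)
set P := (p %/ X).+1 * X.
have pP : p < P by rewrite /P ltn_ceil.
have PX : P <= p + X by rewrite /P mulSn addnC leq_add2r leq_trunc_div.
have Ps := leq_trans PX sp; have PN := leq_trans Ps (ps_le _ _ _).
have h1 : g * t < rk v P by rewrite -(@ps_lt N).
have h2 : rk v P <= g.+1 * t by rewrite leqNgt -(@ps_lt N) // -leqNgt.
apply/eqP; rewrite eqn_leq -ltnS ltn_divLR // leq_divRL //; clearbody P p; lia.
Qed.

Definition block (v : nat -> bool) (l b : nat) : nat -> bool := fun k => v (b * l + k).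

Lemma rk_block v l j : rk v j = rk v (j %/ l * l) + rk (block v l (j %/ l)) (j %% l).
Proof. by rewrite {1}(divn_eq j l) rkD. Qed.

Lemma rk_blockS v l b : rk v (b.+1 * l) = rk v (b * l) + rk (block v l b) l.
Proof. by rewrite mulSn addnC rkD. Qed.

Lemma ps_block N v l b k : k < rk v N -> b * l <= ps N v k -> ps N v k < b.+1 * l ->
  ps N v k = b * l + ps l (block v l b) (k - rk v (b * l)).
Proof.
move=> kN lo hi.
have -> : ps l (block v l b) (k - rk v (b * l)) = ps N v k - b * l.
  apply: ps_unique; rewrite ?/block ?subnKC ?one_ps //.
    by move: hi; rewrite mulSn; lia.
  by have := rkD v (b * l) (ps N v k - b * l); rewrite subnKC // rk_ps //; lia.
by rewrite subnKC.
Qed.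

(** * Enumerative coding of blocks *)

Definition block_set (l : nat) (u : nat -> bool) : {set 'I_l} := [set k : 'I_l | u k].

Definition set_fun (l : nat) (A : {set 'I_l}) (k : nat) : bool :=
  [exists i : 'I_l, (i \in A) && (val i == k)].

Definition subsets (l c : nat) : seq {set 'I_l} := enum [set A : {set 'I_l} | #|A| == c].

Definition code_len (l c : nat) : nat := up_log 2 'C(l, c).

Definition code (l : nat) (u : nat -> bool) : nat := index (block_set l u) (subsets l (rk u l)).

(** The reduction discards the high bits of [y]: a query always reads [l] bits, and those beyond the
    code belong to later blocks. *)
Definition decode (l c y : nat) : nat -> bool :=
  set_fun (nth finset.set0 (subsets l c) (y %% 2 ^ code_len l c)).

Lemma card_block_set l u : #|block_set l u| = rk u l.
Proof.
rewrite -sum1_card big_mkcond /=; apply: eq_bigr => i _.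
by rewrite inE; case: (u i).
Qed.

Lemma set_fun_block l u k : k < l -> set_fun (block_set l u) k = u k.
Proof.
move=> kl; apply/existsP/idP => [[i]|uk].
  by rewrite inE => /andP[ui /eqP <-].
by exists (Ordinal kl); rewrite inE /= uk eqxx.
Qed.

Lemma code_lt l u : code l u < 2 ^ code_len l (rk u l).
Proof.
apply: (@leq_trans 'C(l, rk u l)); last exact: up_logP.
have -> : 'C(l, rk u l) = size (subsets l (rk u l)) by rewrite -cardE card_draws card_ord.
rewrite index_mem mem_enum inE.
by rewrite card_block_set.
Qed.

Lemma code_len_le l c : code_len l c <= l.
Proof.
apply: up_log_min => //; case: (leqP c l) => cl; last by rewrite bin_small.
rewrite -[2]/(1 + 1) expnDn (bigD1 (inord c)) //= inordK ?ltnS // !exp1n !muln1.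
exact: leq_addr.
Qed.

Lemma decode_code l u y k : k < l -> y %% 2 ^ code_len l (rk u l) = code l u ->
  decode l (rk u l) y k = u k.
Proof.
move=> kl yE; rewrite /decode yE /code nth_index ?set_fun_block //.
by rewrite mem_enum inE card_block_set.
Qed.

(** Rounding the logarithm up costs at most one bit per block, hence the factor 2. *)
Lemma code_len_bound l c : c <= l -> 2 ^ code_len l c <= 2 * 'C(l, c).
Proof.
move=> cl; rewrite /code_len; have C0 : 0 < 'C(l, c) by rewrite bin_gt0.
case: (ltnP 1 'C(l, c)) => C1; last by have -> : 'C(l, c) = 1 by lia.
have := up_log_gt0 2 'C(l, c); rewrite C1 /= => u0.
have /andP[h _] := up_log_bounds (isT : 1 < 2) C1.
by rewrite -(prednK u0) expnS leq_mul2l /= ltnW.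
Qed.

(** One term of Vandermonde's sum. Thanks to it, coding the blocks separately loses only the
    rounding. *)
Lemma bin_mul_le a b i j : 'C(a, i) * 'C(b, j) <= 'C(a + b, i + j).
Proof.
rewrite -binomial.Vandermonde (bigD1 (inord i)) //= inordK ?ltnS ?leq_addr //.
by rewrite addKn leq_addr.
Qed.

Definition offset (l : nat) (v : nat -> bool) (b : nat) : nat :=
  \sum_(i < b) code_len l (rk (block v l i) l).

Lemma offsetS l v b : offset l v b.+1 = offset l v b + code_len l (rk (block v l b) l).
Proof. by rewrite /offset big_ord_recr. Qed.

Lemma offset_le l v b : offset l v b <= b * l.
Proof.
elim: b => [|b IHb]; first by rewrite /offset big_ord0.
by rewrite offsetS mulSn addnC leq_add ?code_len_le.
Qed.

Lemma offsetD_le l v b c : offset l v (b + c) <= offset l v b + c * l.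
Proof.
elim: c => [|c IHc]; first by rewrite addn0 leq_addr.
rewrite addnS offsetS mulSn addnCA addnC leq_add ?code_len_le //.
Qed.

Lemma leq_offset l v b c : b <= c -> offset l v b <= offset l v c.
Proof. by move=> bc; rewrite /offset -(subnKC bc) big_split_ord leq_addr. Qed.

Lemma expn_offset_le l v q : 2 ^ offset l v q <= 2 ^ q * 'C(q * l, rk v (q * l)).
Proof.
elim: q => [|q IHq]; first by rewrite /offset big_ord0 mul0n rk0.
rewrite offsetS expnD rk_blockS mulSn [l + _]addnC expnS.
apply: leq_trans (leq_mul IHq (code_len_bound (rk_le _ _))) _.
rewrite [2 * 2 ^ q]mulnC -mulnA -[X in _ <= X]mulnA leq_mul2l mulnCA leq_mul2l.
by rewrite bin_mul_le !orbT.
Qed.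

(** [N %/ l] pays the rounding of the full blocks and [l] the last, partial one; blocks beyond the
    end have weight 0 and an empty code. *)
Lemma offset_binomial l v N b : (forall j, N <= j -> v j = false) -> 0 < l ->
  2 ^ offset l v b <= 2 ^ (N %/ l + l) * 'C(N, rk v N).
Proof.
move=> vN l0; set q := N %/ l.
have bq : offset l v b <= offset l v q + l.
  case: (leqP b q) => bq; first by rewrite (leq_trans (leq_offset _ _ bq)) ?leq_addr.
  have : offset l v b <= offset l v q.+1.
    case: (leqP b q.+1) => bq1; first exact: leq_offset.
    rewrite -(subnKC (ltnW bq1)) /offset big_split_ord /= [X in _ + X]big1 ?addn0 // => i _.
    have -> : rk (block v l (q.+1 + i)) l = 0; last by rewrite /code_len bin0.
    rewrite /rk big1 // => k _; rewrite /block vN //.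
    by rewrite mulnDl -addnA (leq_trans (ltnW (ltn_ceil N l0))) ?leq_addr.
  by move=> h; apply: leq_trans h _; rewrite offsetS leq_add2l code_len_le.
apply: (@leq_trans (2 ^ (offset l v q + l))); first by rewrite leq_exp2l.
rewrite expnD expnD mulnAC leq_mul2r; apply/orP; right.
apply: leq_trans (expn_offset_le _ _ _) _; rewrite leq_mul2l; apply/orP; right.
have qN : q * l <= N by rewrite leq_trunc_div.
have := bin_mul_le (q * l) (N - q * l) (rk v (q * l)) (rk (fun i => v (q * l + i)) (N - q * l)).
rewrite -rkD subnKC //; apply: leq_trans.
by rewrite leq_pmulr // bin_gt0 rk_le.
Qed.

(** * Packed arrays and the memory layout *)

Definition bits_array (len cnt : nat) (F : nat -> nat) : bitseq :=
  mkseq (fun p => odd (F (p %/ len) %/ 2 ^ (p %% len))) (cnt * len).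

Lemma size_bits_array len cnt F : size (bits_array len cnt F) = cnt * len.
Proof. exact: size_mkseq. Qed.

Lemma sum_bits x l : \sum_(k < l) odd (x %/ 2 ^ k) * 2 ^ k = x %% 2 ^ l.
Proof.
elim: l => [|l IHl]; first by rewrite big_ord0 modn1.
rewrite big_ord_recr /= IHl -modn2 [in RHS](divn_eq x (2 ^ l)).
have x0 := ltn_pmod x (expn_gt0 2 l : 0 < 2 ^ l).
move: (x %% _) (x %/ _) x0 => r q x0.
rewrite [in RHS](divn_eq q 2) mulnDl -mulnA -expnS -addnA modnMDl.
rewrite [RHS]modn_small; first by rewrite addnC.
rewrite expnS mul2n -addnn -addnS leq_add //.
by rewrite -[X in _ <= X]mul1n leq_mul2r -ltnS ltn_mod orbT.
Qed.

Lemma bits_val_array pre post len cnt F i : i < cnt ->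
  bits_val (pre ++ bits_array len cnt F ++ post) (size pre + i * len) len = F i %% 2 ^ len.
Proof.
move=> ic; rewrite -sum_bits; apply: eq_bigr => k _; congr (nat_of_bool _ * _).
have kl := ltn_ord k.
have il : i * len + k < cnt * len.
  by apply: (@leq_trans (i.+1 * len)); rewrite ?leq_mul2r ?ic ?orbT // mulSn addnC ltn_add2r.
rewrite nth_cat -addnA ltnNge leq_addr /= addKn nth_cat size_bits_array il nth_mkseq //.
by rewrite divnMDl ?(leq_ltn_trans _ kl) // (divn_small kl) addn0 modnMDl (modn_small kl).
Qed.

Definition payload (l : nat) (v : nat -> bool) (s : seq nat) : bitseq :=
  flatten [seq bits_array (code_len l (rk (block v l i) l)) 1 (fun=> code l (block v l i))
          | i <- s].

Lemma size_payload l v b : size (payload l v (iota 0 b)) = offset l v b.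
Proof.
elim: b => [|b IHb]; first by rewrite /offset big_ord0.
rewrite -addn1 iotaD /payload map_cat flatten_cat size_cat [size _]IHb.
by rewrite /= cats0 size_bits_array mul1n addn1 offsetS add0n.
Qed.

Lemma bits_val_payload pre l v nb b : b < nb ->
  bits_val (pre ++ payload l v (iota 0 nb)) (size pre + offset l v b)
    (code_len l (rk (block v l b) l)) = code l (block v l b).
Proof.
move=> bn; rewrite -(subnKC (ltnW bn)) iotaD -(prednK (_ : 0 < nb - b)) ?subn_gt0 //=.
rewrite /payload map_cat flatten_cat /= catA add0n.
have := @bits_val_array (pre ++ payload l v (iota 0 b))
  (payload l v (iota b.+1 (nb - b).-1)) (code_len l (rk (block v l b) l)) 1
  (fun=> code l (block v l b)) 0 isT.
rewrite mul0n addn0 size_cat size_payload => ->.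
by rewrite modn_small // code_lt.
Qed.

(** All fields of one width form a single array of records, which leaves one base address per width
    to compute; each field is then as long as the longest one. *)
Definition interleave (fs : seq (nat -> nat)) (k : nat) : nat :=
  nth (fun=> 0) fs (k %% size fs) (k %/ size fs).

Lemma interleaveE fs i k : k < size fs -> interleave fs (i * size fs + k) = nth (fun=> 0) fs k i.
Proof.
move=> kf; rewrite /interleave modnMDl modn_small // divnMDl ?(leq_ltn_trans _ kf) //.
by rewrite divn_small // addn0.
Qed.

Section Layout.
Variables (tau alpha N : nat) (v : nat -> bool).

(** With [t = 2 ^ tau], blocks have [t^2] bits. Large groups have [t^4] ones and are sparse from a
    span of [t^8]; small groups have [t] ones and are sparse from a span of [t^2], one block. As
    each span is the square of the group size, the slots hold only about [N / t^4] and [N / t]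
    entries. *)
Definition grp2 := 2 ^ tau.
Definition blk := grp2 * grp2.
Definition grp1 := blk * blk.
Definition span1 := grp1 * grp1.
(** Relative values are at most [span1 + blk], while [omega] bits reach [span1 * span1]. *)
Definition omega := 16 * tau.
Definition big_count := N %/ grp1 + grp1 + 3.
(** Long enough for the indices of blocks, small groups and slots, and also for those of the two
    universal tables. *)
Definition small_count := N %/ grp2 + (blk + 1) * (blk + 1) * 2 ^ blk + 3.
Definition base1 := 4 * blk.
Definition base2 := base1 + 4 * big_count * alpha.
Definition base3 := base2 + 7 * small_count * omega.

(* The one number [e] of the sparse group of [t] ones that starts in slot [s] of [X]
   positions (see [sparse_group]). *)
Definition slot_one (X t s e : nat) : nat := ps N v ((rk v (s.+1 * X)).-1 %/ t * t + e).

(** Unpacks the index [(c * 2 ^ blk + y) * (blk + 1) + j] of weight [c], window [y] and argument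
    [j <= blk]. *)
Definition table (F : (nat -> bool) -> nat -> nat) (i : nat) : nat :=
  F (decode blk (i %/ (blk + 1) %/ 2 ^ blk) ((i %/ (blk + 1)) %% 2 ^ blk)) (i %% (blk + 1)).

Definition big_fields : seq (nat -> nat) :=
  [:: fun i => rk v (i * blk * blk);
      fun i => offset blk v (i * blk);
      fun i => ps N v (i * grp1);
      fun i => slot_one span1 grp1 (i %/ grp1) (i %% grp1)].

Definition small_fields : seq (nat -> nat) :=
  [:: fun i => rk v (i * blk) - rk v (i %/ blk * blk * blk);
      fun i => offset blk v i - offset blk v (i %/ blk * blk);
      fun i => rk (block v blk i) blk;
      fun i => ps N v (i * grp2) - ps N v (i %/ (grp2 * blk) * grp1);
      fun i => slot_one blk grp2 (i %/ grp2) (i %% grp2) - i %/ grp2 * blk;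
      table rk;
      table (ps blk)].

(* Its lowest set bit reveals [2 ^ blk], hence the widths of the two fields above it. *)
Definition header_val := 2 ^ blk * (2 * (tau + 2 ^ blk * alpha) + 1).

Definition layout : bitseq :=
  bits_array base1 1 (fun=> header_val) ++
  bits_array alpha (4 * big_count) (interleave big_fields) ++
  bits_array omega (7 * small_count) (interleave small_fields) ++
  payload blk v (iota 0 (N %/ blk + 2)).

Lemma size_layout : size layout = base3 + offset blk v (N %/ blk + 2).
Proof.
by rewrite /layout !size_cat !size_bits_array size_payload mul1n /base3 /base2 !addnA.
Qed.

Lemma layout_header : bits_val layout 0 base1 = header_val %% 2 ^ base1.
Proof. by have := @bits_val_array [::] _ base1 1 (fun=> header_val) 0 isT => ->. Qed.

Lemma layout_big k i : k < 4 -> i < big_count ->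
  bits_val layout (base1 + (i * 4 + k) * alpha) alpha
  = nth (fun=> 0) big_fields k i %% 2 ^ alpha.
Proof.
move=> k4 ic; rewrite -(interleaveE i (_ : k < size big_fields)) // /layout.
set pre := bits_array base1 _ _.
have -> : base1 = size pre by rewrite size_bits_array mul1n.
by apply: bits_val_array; rewrite /=; lia.
Qed.

Lemma layout_small k i : k < 7 -> i < small_count ->
  bits_val layout (base2 + (i * 7 + k) * omega) omega
  = nth (fun=> 0) small_fields k i %% 2 ^ omega.
Proof.
move=> k7 ic; rewrite -(interleaveE i (_ : k < size small_fields)) // /layout catA.
set pre := _ ++ bits_array alpha _ _.
have -> : base2 = size pre by rewrite size_cat !size_bits_array mul1n.
by apply: bits_val_array; rewrite /=; lia.
Qed.

Lemma layout_payload b : b < N %/ blk + 2 ->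
  bits_val layout (base3 + offset blk v b) (code_len blk (rk (block v blk b) blk))
  = code blk (block v blk b).
Proof.
move=> bn; rewrite /layout !catA; set pre := _ ++ bits_array omega _ _.
have -> : base3 = size pre by rewrite !size_cat !size_bits_array mul1n.
exact: bits_val_payload.
Qed.

End Layout.

(** * Query expressions *)

Lemma land_complement m a b : a + b + 1 = 2 ^ m -> Nat.land a b = 0.
Proof.
elim: m a b => [|m IHm] a b; first by case: a => //= a; lia.
rewrite expnS => ab.
have aE := odd_double_half a; have bE := odd_double_half b.
have [ao|ao] := boolP (odd a); have [bo|bo] := boolP (odd b);
  rewrite ?ao ?bo ?(negbTE ao) ?(negbTE bo) in aE bE.
- by exfalso; move: ab; rewrite -aE -bE; lia.
- have {1}-> : a = (2 * a./2 + 1)%coq_nat by lia.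
  have {1}-> : b = (2 * b./2)%coq_nat by lia.
  rewrite (PeanoNat.Nat.land_odd_even : forall x y, Nat.land _ _ = _) IHm //; lia.
- have {1}-> : a = (2 * a./2)%coq_nat by lia.
  have {1}-> : b = (2 * b./2 + 1)%coq_nat by lia.
  rewrite (PeanoNat.Nat.land_even_odd : forall x y, Nat.land _ _ = _) IHm //; lia.
- by exfalso; move: ab; rewrite -aE -bE; lia.
Qed.

(** The two's-complement trick: once [2 ^ k] is divided out, an odd number and its negative share
    bit 0 and are complementary above it. It yields a power of two without loop or logarithm. *)
Lemma land_opp k m c : 2 * c + 1 < 2 ^ m ->
  Nat.land (2 ^ k * (2 * c + 1)) (2 ^ (k + m) - 2 ^ k * (2 * c + 1)) = 2 ^ k.
Proof.
move=> cm; rewrite expnD -mulnBr; elim: k => [|k IHk].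
  rewrite expn0 !mul1n; case: m cm => [|m]; first by rewrite expn0; lia.
  rewrite expnS => cm.
  have -> : 2 * 2 ^ m - (2 * c + 1) = (2 * (2 ^ m - c - 1) + 1)%coq_nat by lia.
  have -> : 2 * c + 1 = (2 * c + 1)%coq_nat by lia.
  rewrite (PeanoNat.Nat.land_odd_odd : forall x y, Nat.land _ _ = _).
  by rewrite (@land_complement m) //; lia.
rewrite !expnS -!mulnA.
have e x : 2 * x = (2 * x)%coq_nat by lia.
by rewrite 2!e (PeanoNat.Nat.land_even_even : forall x y, Nat.land _ _ = _) IHk -e.
Qed.

Definition lowbit (x : expr) : expr := Bin OpAnd x (sub (Cst 0) x).

Lemma eval_lowbit w D a x k c : let X := 2 ^ k * (2 * c + 1) in
  eval w D a x = X %% 2 ^ w -> X < 2 ^ w -> eval w D a (lowbit x) = 2 ^ k %% 2 ^ w.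
Proof.
move=> X Ex XW; have En := eval_neg Ex.
have X0 : 0 < X by rewrite /X muln_gt0 expn_gt0 addn1.
have kw : k < w by rewrite -(@ltn_exp2l 2) // (leq_ltn_trans _ XW) // /X leq_pmulr ?addn1.
have cm : 2 * c + 1 < 2 ^ (w - k).
  by rewrite -(@ltn_pmul2l (2 ^ k)) ?expn_gt0 // -expnD subnKC // ltnW.
move: En Ex => /=; rewrite (modn_small XW) => -> ->.
rewrite /eval_binop (@modn_small (2 ^ w - X)); last by rewrite -subn_gt0 subKn // ltnW.
by rewrite -{1}(subnKC (ltnW kw)) land_opp.
Qed.

Arguments eval : simpl never.

(** This form of the ceiling avoids [n + delta - 1], which could exceed a word before the
    division. *)
Definition expr_N : expr := add (dvn (sub arg_n (Cst 1)) arg_d) (Cst 1).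
Definition expr_head : expr := Peek (Cst 0).
Definition expr_pow : expr := lowbit expr_head.
Definition expr_tau : expr := mdn (dvn expr_head (mul expr_pow (Cst 2))) expr_pow.
Definition expr_alpha : expr :=
  mdn (dvn expr_head (mul (mul expr_pow (Cst 2)) expr_pow)) expr_pow.
Definition expr_grp2 : expr := shl (Cst 1) expr_tau.
Definition expr_blk : expr := mul expr_grp2 expr_grp2.
Definition expr_grp1 : expr := mul expr_blk expr_blk.
Definition expr_span1 : expr := mul expr_grp1 expr_grp1.
Definition expr_omega : expr := mul (Cst 16) expr_tau.
Definition expr_big_count : expr := add (add (dvn expr_N expr_grp1) expr_grp1) (Cst 3).
Definition expr_small_count : expr :=
  add (add (dvn expr_N expr_grp2)
           (mul (mul (add expr_blk (Cst 1)) (add expr_blk (Cst 1))) expr_pow)) (Cst 3).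
Definition expr_base1 : expr := mul (Cst 4) expr_blk.
Definition expr_base2 : expr := add expr_base1 (mul (mul (Cst 4) expr_big_count) expr_alpha).
Definition expr_base3 : expr := add expr_base2 (mul (mul (Cst 7) expr_small_count) expr_omega).
Definition expr_big (k : nat) (i : expr) : expr :=
  read expr_base1 (mul (add (mul i (Cst 4)) (Cst k)) expr_alpha) expr_alpha.
Definition expr_small (k : nat) (i : expr) : expr :=
  read expr_base2 (mul (add (mul i (Cst 7)) (Cst k)) expr_omega) expr_omega.

Definition expr_rank_blk (b : expr) : expr :=
  add (expr_big 0 (dvn b expr_blk)) (expr_small 0 b).
Definition expr_ptr (b : expr) : expr := add (expr_big 1 (dvn b expr_blk)) (expr_small 1 b).
Definition expr_window (b : expr) : expr := read expr_base3 (expr_ptr b) expr_blk.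
Definition expr_table (k : nat) (b j : expr) : expr :=
  expr_small k (add (mul (add (mul (expr_small 2 b) expr_pow) (expr_window b))
                         (add expr_blk (Cst 1))) j).
Definition expr_rank (j : expr) : expr :=
  add (expr_rank_blk (dvn j expr_blk)) (expr_table 5 (dvn j expr_blk) (mdn j expr_blk)).
Definition expr_start (h : expr) : expr :=
  add (expr_big 2 (dvn h (mul expr_grp2 expr_blk))) (expr_small 3 h).
Definition expr_in_block (k b : expr) : expr :=
  add (mul b expr_blk) (expr_table 6 b (sub k (expr_rank_blk b))).
(** A dense small group spans less than a block, so its ones lie in the block [b] of its start or in
    the next one; the rank at the border decides. *)
Definition expr_near (k b : expr) : expr :=
  cond (ltx k (expr_rank_blk (add b (Cst 1)))) (expr_in_block k b)
       (expr_in_block k (add b (Cst 1))).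
Definition expr_far2 (k b : expr) : expr :=
  add (mul b expr_blk) (expr_small 4 (add (mul b expr_grp2) (mdn k expr_grp2))).
Definition expr_dense (k h : expr) : expr :=
  cond (ltx (sub (expr_start (add h (Cst 1))) (expr_start h)) expr_blk)
       (expr_near k (dvn (expr_start h) expr_blk)) (expr_far2 k (dvn (expr_start h) expr_blk)).
Definition expr_far1 (k s : expr) : expr :=
  expr_big 3 (add (mul s expr_grp1) (mdn k expr_grp1)).
Definition expr_group (k g : expr) : expr :=
  cond (ltx (sub (expr_big 2 (add g (Cst 1))) (expr_big 2 g)) expr_span1)
       (expr_dense k (dvn k expr_grp2)) (expr_far1 k (dvn (expr_big 2 g) expr_span1)).
Definition expr_select (k : expr) : expr := expr_group k (dvn k expr_grp1).

Section Dimensions.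
Variable tau : nat.
Local Notation t := (grp2 tau).
Local Notation l := (blk tau).
Local Notation X1 := (span1 tau).

Lemma blkE : l = 2 ^ (2 * tau). Proof. by rewrite /blk /grp2 -expnD mul2n addnn. Qed.

Lemma span1E : X1 = 2 ^ (8 * tau).
Proof. by rewrite /span1 /grp1 blkE -!expnD; congr (_ ^ _); lia. Qed.

Lemma omegaE : 2 ^ omega tau = X1 * X1.
Proof. by rewrite span1E -expnD; congr (_ ^ _); rewrite /omega; lia. Qed.

Hypothesis tau2 : 2 <= tau.

(** Equality holds at [tau = 2], and [tau = 1] fails; this is the origin of the lower bound 2 in
    [tau_of]. *)
Lemma tau_blk : 8 * tau <= l.
Proof.
rewrite blkE; move: tau2; elim: (tau) => [|[|[|s]] IHs] // _.
have := IHs isT; rewrite [2 * s.+3]mulnS expnD; lia.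
Qed.

Lemma grp2_ge4 : 4 <= t.
Proof. by rewrite /grp2 -[4]/(2 ^ 2) leq_exp2l. Qed.

Lemma span1_le : X1 <= 2 ^ l.
Proof. by rewrite span1E leq_exp2l // tau_blk. Qed.

End Dimensions.

(** The unknown [j] collects what follows the two parameters in the first word, including directory
    bits when [w > 4 * l]; the decoding must be insensitive to it. *)
Lemma head_word w tau alpha N v : let l := blk tau in
    4 * l <= w -> 2 <= tau -> alpha < 2 ^ l ->
  exists j, memory w (layout tau alpha N v) 0
    = 2 ^ l * (2 * (tau + 2 ^ l * (alpha + 2 ^ l * j)) + 1).
Proof.
move=> l lw tau2 alY.
have tl : 8 * tau <= l := tau_blk tau2; have l0 : 0 < l by lia.
rewrite memoryE mul0n -(subnKC lw) bits_valD -/(base1 tau) layout_header.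
set rest := bits_val _ _ _.
have tY : tau < 2 ^ l by rewrite (leq_ltn_trans _ (ltn_expl l (ltnSn 1))) //; lia.
(* The header fields end at bit [3 * l + 1] but the directories start at bit [4 * l], whence the gap
   of [l.-1] bits. *)
exists (2 ^ l.-1 * rest).
have e4 : 2 ^ base1 tau = 2 ^ l * (2 * (2 ^ l * (2 ^ l * 2 ^ l.-1))).
  by rewrite -!expnD -expnS -expnD /base1; congr (_ ^ _); lia.
have e1 : 2 ^ l = 2 * 2 ^ l.-1 by rewrite -expnS prednK.
have Z0 : 0 < 2 ^ l.-1 by rewrite expn_gt0.
rewrite /header_val e4.
move: (2 ^ l) (2 ^ l.-1) rest tY alY e1 Z0 {e4 tl l0} => Y Z r tY aY e1 Z0.
rewrite modn_small; first by lia.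
rewrite ltn_pmul2l; last by lia.
have : tau + Y * alpha < Y * Y by nia.
nia.
Qed.

(** * Correctness of the queries on a layout *)

Section Queries.
Variables (w tau alpha N : nat) (v : nat -> bool) (a : nat -> nat).
Local Notation D := (layout tau alpha N v).
Local Notation ev := (eval w D a).
Local Notation W := (2 ^ w).
Local Notation t := (grp2 tau).
Local Notation l := (blk tau).
Local Notation t1 := (grp1 tau).
Local Notation X1 := (span1 tau).
Hypotheses (aw : a 3 = w) (lw : 4 * l <= w) (tau2 : 2 <= tau).
Hypotheses (N0 : 0 < N) (NW : N < W) (EN : ev expr_N = N %% W).
Hypotheses (Nalpha : N < 2 ^ alpha) (alw : alpha <= w) (alY : alpha < 2 ^ l).
Hypothesis vN : forall j, N <= j -> v j = false.
Hypothesis base3W : base3 tau alpha N < W.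

Lemma word_ge4 : 4 <= w.
Proof. have := (grp2_ge4 tau2); move: lw; rewrite /blk; nia. Qed.

Lemma small_params : [/\ t <= l, l <= t1, t1 <= X1 & 16 * tau <= w].
Proof.
have t4 := (grp2_ge4 tau2); have tl := (tau_blk tau2).
have h1 : t <= l by rewrite /blk leq_pmulr //; lia.
have h2 : l <= t1 by rewrite /grp1 leq_pmulr //; lia.
by split=> //; [rewrite /span1 leq_pmulr //; lia|lia].
Qed.

Lemma eval_head_params : [/\ ev expr_pow = 2 ^ l %% W, ev expr_tau = tau %% W
  & ev expr_alpha = alpha %% W].
Proof.
have [j mE] := head_word N v lw tau2 alY.
have Eh : ev expr_head = memory w D 0 %% W.
  by apply: (eval_fetch (eval_cst w D a 0)); rewrite expn_gt0.
have hW : memory w D 0 < W := memory_lt _ _ _.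
have Ep : ev expr_pow = 2 ^ l %% W.
  by rewrite mE in Eh hW; apply: (eval_lowbit Eh hW).
have tl := (tau_blk tau2); have l0 : 0 < l by lia.
have tY : tau < 2 ^ l by rewrite (leq_ltn_trans _ (ltn_expl l (ltnSn 1))) //; lia.
have p1 : 2 ^ l < W by rewrite ltn_exp2l //; lia.
have p2 : 2 ^ l * 2 < W by rewrite mulnC -expnS ltn_exp2l //; lia.
have p3 : 2 ^ l * 2 * 2 ^ l < W by rewrite [_ * 2]mulnC -expnS -expnD ltn_exp2l //; lia.
have Y0 : 0 < 2 ^ l by rewrite expn_gt0.
have E2 := eval_mul Ep (eval_cst w D a 2).
have E3 := eval_mul E2 Ep.
have d1 : memory w D 0 %/ (2 ^ l * 2) = (alpha + 2 ^ l * j) * 2 ^ l + tau.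
  rewrite mE divnMA mulKn // [2 * _]mulnC divnMDl // divn_small // addn0.
  by rewrite addnC [2 ^ l * _]mulnC.
have d2 : memory w D 0 %/ (2 ^ l * 2 * 2 ^ l) = j * 2 ^ l + alpha.
  by rewrite divnMA d1 divnMDl // (divn_small tY) addn0 addnC mulnC.
split=> //.
- have := eval_mod (eval_div Eh E2 hW p2) Ep.
  rewrite d1 modnMDl (@modn_small tau (2 ^ l)) //; apply=> //.
  by rewrite -d1 (leq_ltn_trans (leq_div _ _)).
- have := eval_mod (eval_div Eh E3 hW p3) Ep.
  rewrite d2 modnMDl (@modn_small alpha (2 ^ l)) //; apply=> //.
  by rewrite -d2 (leq_ltn_trans (leq_div _ _)).
Qed.

Lemma span1W : X1 < W.
Proof.
apply: (leq_ltn_trans (span1_le tau2)); rewrite ltn_exp2l //.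
by have := (tau_blk tau2); lia.
Qed.

Lemma eval_params : [/\ ev expr_grp2 = t %% W, ev expr_blk = l %% W,
  ev expr_grp1 = t1 %% W, ev expr_span1 = X1 %% W & ev expr_omega = omega tau %% W].
Proof.
have [_ Et _] := eval_head_params.
have tW : tau < W by have [_ _ _] := small_params; have := ltn_expl w (ltnSn 1); lia.
have E1 : ev expr_grp2 = t %% W by have := eval_shl (eval_cst w D a 1) Et tW; rewrite mul1n.
have E2 := eval_mul E1 E1; have E3 := eval_mul E2 E2; have E4 := eval_mul E3 E3.
by split=> //; apply: eval_mul (eval_cst w D a 16) Et.
Qed.

Lemma eval_bases : [/\ ev expr_base1 = base1 tau %% W, ev expr_base2 = base2 tau alpha N %% W
  & ev expr_base3 = base3 tau alpha N %% W].
Proof.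
have [Ep Et Ea] := eval_head_params; have [E2 El E1 _ Eo] := eval_params.
have [tl l1 t1x _] := small_params; have xW := span1W.
have Ec := eval_cst w D a.
have Eb1 : ev expr_base1 = base1 tau %% W := eval_mul (Ec 4) El.
have En : ev expr_big_count = big_count tau N %% W.
  apply: (eval_add _ (Ec 3)); apply: (eval_add _ E1); apply: (eval_div EN E1) => //.
  exact: leq_ltn_trans t1x xW.
have Es : ev expr_small_count = small_count tau N %% W.
  apply: (eval_add _ (Ec 3)); apply: eval_add; first apply: (eval_div EN E2) => //.
    by apply: leq_ltn_trans xW; apply: leq_trans t1x; apply: leq_trans l1.
  exact: (eval_mul (eval_mul (eval_add El (Ec 1)) (eval_add El (Ec 1))) Ep).
have Eb2 := eval_add Eb1 (eval_mul (eval_mul (Ec 4) En) Ea).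
have Eb3 := eval_add Eb2 (eval_mul (eval_mul (Ec 7) Es) Eo).
by split.
Qed.

Lemma bases_lt : base1 tau < W /\ base2 tau alpha N < W.
Proof. by move: base3W; rewrite /base3 /base2; lia. Qed.

Lemma eval_big k e i : k < 4 -> i < big_count tau N -> ev e = i %% W ->
  ev (expr_big k e) = (nth (fun=> 0) (big_fields tau N v) k i %% 2 ^ alpha) %% W.
Proof.
move=> k4 ic Ee.
have [_ _ Ea] := eval_head_params; have [Eb1 _ _] := eval_bases; have [b1W b2W] := bases_lt.
have Ec := eval_cst w D a.
have Ei := eval_mul (eval_add (eval_mul Ee (Ec 4)) (Ec k)) Ea.
rewrite -layout_big //; apply: (eval_read aw word_ge4 Eb1 Ei Ea) => //.
apply: leq_ltn_trans b2W; rewrite /base2.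
have : (i * 4 + k) * alpha <= 4 * big_count tau N * alpha.
  by rewrite leq_mul2r; apply/orP; right; lia.
lia.
Qed.

Lemma eval_small k e i : k < 7 -> i < small_count tau N -> ev e = i %% W ->
  ev (expr_small k e) = (nth (fun=> 0) (small_fields tau N v) k i %% 2 ^ omega tau) %% W.
Proof.
move=> k7 ic Ee.
have [_ _ _ _ Eo] := eval_params; have [_ Eb2 _] := eval_bases; have [b1W b2W] := bases_lt.
have Ec := eval_cst w D a; have [_ _ _ ow] := small_params.
have Ei := eval_mul (eval_add (eval_mul Ee (Ec 7)) (Ec k)) Eo.
rewrite -(layout_small alpha) //; apply: (eval_read aw word_ge4 Eb2 Ei Eo) => //.
apply: leq_ltn_trans base3W; rewrite /base3.
have : (i * 7 + k) * omega tau <= 7 * small_count tau N * omega tau.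
  by rewrite leq_mul2r; apply/orP; right; lia.
lia.
Qed.


Ltac lin := repeat match goal with H : eval _ _ _ _ = _ |- _ => clear H end; lia.

Lemma blkW : l < W.
Proof. by have [_ l1 t1x _] := small_params; have := span1W; lin. Qed.

Lemma grp1W : t1 < W.
Proof. by have [_ l1 t1x _] := small_params; have := span1W; lin. Qed.

Lemma grp2W : t < W.
Proof. by have [tl l1 t1x _] := small_params; have := span1W; lin. Qed.

Lemma blk_gt0 : 0 < l. Proof. by have [+ _ _ _] := small_params; have := (grp2_ge4 tau2); lin. Qed.

Lemma blocks_le : N %/ l < N.
Proof. by apply: ltn_Pdiv => //; have [+ _ _ _] := small_params; have := (grp2_ge4 tau2); lin. Qed.

Lemma rk_leN j : rk v j <= N.
Proof.
case: (leqP j N) => jN; first exact: leq_trans (rk_le _ _) jN.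
rewrite -(subnKC (ltnW jN)) rkD [X in _ + X]/rk big1 ?addn0 ?rk_le // => i _.
by rewrite vN ?leq_addr.
Qed.

Lemma alpha_val x : x <= N -> x %% 2 ^ alpha = x.
Proof. by move=> xN; rewrite modn_small // (leq_ltn_trans xN). Qed.

Lemma omega_val x : x <= X1 + l -> x %% 2 ^ omega tau = x.
Proof.
move=> xX; rewrite modn_small // omegaE (leq_ltn_trans xX) //.
have [tl l1 t1x _] := small_params; have := (grp2_ge4 tau2); nia.
Qed.

(** One block past the last is allowed because [expr_near] asks for the rank at the start of the
    following block. *)
Lemma big_index b : b <= (N %/ l).+1 -> b %/ l < big_count tau N.
Proof.
move=> bN; have l0 := blk_gt0.
apply: (@leq_ltn_trans (N %/ l %/ l).+1); last by rewrite -divnMA /big_count -/t1; lin.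
apply: leq_trans (leq_div2r _ bN) _.
apply: (@leq_trans ((1 * l + N %/ l) %/ l)); first by rewrite leq_div2r //; lin.
by rewrite divnMDl.
Qed.

Lemma small_index b : b <= (N %/ t).+1 -> b < small_count tau N.
Proof. by rewrite /small_count; lin. Qed.

Lemma table_index : (l + 1) * (l + 1) * 2 ^ l < small_count tau N.
Proof. by rewrite /small_count; move: (_ * 2 ^ _) (_ %/ _) => x y; lia. Qed.

Lemma blocks_small b : b <= (N %/ l).+1 -> b <= (N %/ t).+1.
Proof.
have [tl _ _ _] := small_params; move=> bN; apply: leq_trans bN _; rewrite ltnS leq_div2l //.
by have := (grp2_ge4 tau2); lin.
Qed.

Lemma eval_rank_blk e b : b <= (N %/ l).+1 -> ev e = b %% W ->
  ev (expr_rank_blk e) = rk v (b * l) %% W.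
Proof.
move=> bN Ee; have bW : b < W by have := blocks_le; lin.
have [_ El _ _ _] := eval_params.
have E1 := eval_big (isT : 0 < 4) (big_index bN) (eval_div Ee El bW blkW).
have E2 := eval_small (isT : 0 < 7) (small_index (blocks_small bN)) Ee.
have := eval_add E1 E2; rewrite /= alpha_val ?rk_leN //.
have split_b : b * l = b %/ l * l * l + b %% l * l by rewrite -mulnDl -divn_eq.
rewrite omega_val; first by rewrite subnKC // leq_rk // split_b leq_addr.
have [tl l1 t1x _] := small_params; have l0 := blk_gt0.
rewrite {1}split_b rkD addKn (leq_trans (rk_le _ _)) //.
apply: (@leq_trans t1); last exact: leq_trans t1x (leq_addr _ _).
by rewrite /grp1 leq_mul2r ltnW ?orbT // ltn_mod.
Qed.

Lemma eval_ptr e b : b <= N %/ l -> ev e = b %% W ->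
  ev (expr_ptr e) = offset l v b %% W.
Proof.
move=> bN Ee; have bW : b < W by have := blocks_le; lin.
have [_ El _ _ _] := eval_params; have l0 := blk_gt0.
have E1 := eval_big (isT : 1 < 4) (big_index (leqW bN)) (eval_div Ee El bW blkW).
have E2 := eval_small (isT : 1 < 7) (small_index (blocks_small (leqW bN))) Ee.
have := eval_add E1 E2; rewrite /= alpha_val; last first.
  apply: leq_trans (offset_le _ _ _) _; apply: leq_trans (leq_trunc_div N l).
  by rewrite leq_mul2r (leq_trans (leq_trunc_div _ _)) ?orbT.
rewrite omega_val; first by rewrite subnKC // leq_offset // leq_trunc_div.
have [tl l1 t1x _] := small_params.
rewrite leq_subLR {1}(divn_eq b l) (leq_trans (offsetD_le _ _ _ _)) // leq_add2l.
apply: (@leq_trans t1); last exact: leq_trans t1x (leq_addr _ _).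
by rewrite /grp1 leq_mul2r ltnW ?orbT // ltn_mod.
Qed.

(** Applied to [rk] and [ps l]. The window begins with the code of block [b], and decoding recovers
    the block only below [l]; hence the requirement that [F] depend on those values alone. *)
Lemma eval_table (F : (nat -> bool) -> nat -> nat) k e j b i :
    2 < k < 7 -> nth (fun=> 0) (small_fields tau N v) k =1 table tau F ->
    (forall f g x, (forall y, y < l -> f y = g y) -> x <= l -> F f x = F g x) ->
    (forall f x, x <= l -> F f x <= l) ->
    b <= N %/ l -> i <= l -> ev e = b %% W -> ev j = i %% W ->
  ev (expr_table k e j) = F (block v l b) i %% W.
Proof.
move=> /andP[k2 k7] kF eqF leF bN il Ee Ej.
have [Ep _ _] := eval_head_params; have [_ El _ _ _] := eval_params.
have [_ _ Eb3] := eval_bases; have l0 := blk_gt0.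
have Ec : ev (expr_small 2 e) = rk (block v l b) l %% W.
  have := eval_small (isT : 2 < 7) (small_index (blocks_small (leqW bN))) Ee.
  by rewrite /= omega_val // (leq_trans (rk_le _ _)) // leq_addl.
have oW : offset l v b < W.
  apply: leq_ltn_trans NW; apply: leq_trans (offset_le _ _ _) _.
  by apply: leq_trans (leq_trunc_div N l); rewrite leq_mul2r bN orbT.
have lw' : l <= w by lin.
have Ew := eval_read aw word_ge4 Eb3 (eval_ptr bN Ee) El base3W oW lw'.
set c := rk (block v l b) l in Ec *; set y := bits_val _ _ _ in Ew.
have yE : y %% 2 ^ code_len l c = code l (block v l b).
  rewrite /y bits_val_mod ?code_len_le // layout_payload //; lin.
have yl : y < 2 ^ l := bits_val_lt _ _ _.
have cl : c <= l := rk_le _ _.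
set idx := (c * 2 ^ l + y) * (l + 1) + i.
have il' : i < l + 1 by lin.
have d1 : idx %/ (l + 1) = c * 2 ^ l + y by rewrite divnMDl ?addn1 // -addn1 divn_small ?addn0.
have d2 : idx %% (l + 1) = i by rewrite modnMDl modn_small.
have d3 : (c * 2 ^ l + y) %/ 2 ^ l = c by rewrite divnMDl ?expn_gt0 // divn_small ?addn0.
have d4 : (c * 2 ^ l + y) %% 2 ^ l = y by rewrite modnMDl modn_small.
have idx_lt : idx < small_count tau N.
  apply: (@leq_ltn_trans ((l + 1) * (l + 1) * 2 ^ l)); last exact: table_index.
  rewrite mulnAC /idx.
  apply: (@leq_trans ((c * 2 ^ l + y).+1 * (l + 1))); first by rewrite mulSn; lin.
  rewrite leq_mul2r addn1 /=; apply: (@leq_trans (c.+1 * 2 ^ l)); first by rewrite mulSn; lin.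
  by rewrite leq_mul2r ltnS cl orbT.
have Ei := eval_add (eval_mul (eval_add (eval_mul Ec Ep) Ew)
  (eval_add El (eval_cst w D a 1))) Ej.
have := eval_small k7 idx_lt Ei; rewrite /expr_table => ->.
rewrite kF /table d1 d2 d3 d4 omega_val; last by rewrite (leq_trans (leF _ _ _)) // leq_addl.
congr (_ %% _); apply: eqF => // z zl; exact: decode_code.
Qed.

Lemma eval_rank e j : j <= N -> ev e = j %% W -> ev (expr_rank e) = rk v j %% W.
Proof.
move=> jN Ee; have jW : j < W by lin.
have [_ El _ _ _] := eval_params; have l0 := blk_gt0.
have Ed := eval_div Ee El jW blkW; have Em := eval_mod Ee El jW blkW.
have bN : j %/ l <= N %/ l by rewrite leq_div2r.
rewrite (rk_block v l j); apply: eval_add; first exact: eval_rank_blk (leqW bN) Ed.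
apply: (@eval_table rk) Ed Em => //; last by rewrite ltnW // ltn_mod.
  by move=> f g x fg xl; apply: eq_rk => y yx; apply: fg; apply: leq_trans yx xl.
by move=> f x xl; apply: leq_trans (rk_le _ _) xl.
Qed.

Lemma ps_lt_rk k j : k < rk v N -> (ps N v k < j) = (k < rk v j).
Proof.
move=> kN; case: (leqP j N) => jN; first by rewrite ps_lt.
rewrite (leq_ltn_trans (ps_le _ _ _) jN) (leq_trans kN) //.
by apply: leq_rk; apply: ltnW.
Qed.

Lemma eval_in_block ek k e b : k < rk v N -> b * l <= ps N v k < b.+1 * l ->
  ev ek = k %% W -> ev e = b %% W -> ev (expr_in_block ek e) = ps N v k %% W.
Proof.
move=> kN /andP[lo hi] Ek Ee; have l0 := blk_gt0.
have [_ El _ _ _] := eval_params.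
have bN : b <= N %/ l by rewrite leq_divRL // (leq_trans lo) // ps_le.
have rk_lo : rk v (b * l) <= k by rewrite leqNgt -ps_lt_rk // -leqNgt.
have kl : k - rk v (b * l) <= l.
  have : k < rk v (b.+1 * l) by rewrite -ps_lt_rk.
  by rewrite rk_blockS; have := rk_le (block v l b) l; lin.
rewrite (ps_block kN lo hi); apply: eval_add; first exact: eval_mul.
have Er := eval_rank_blk (leqW bN) Ee.
apply: (@eval_table (ps l)) Ee (eval_sub Ek Er rk_lo) => //.
  by move=> f g x fg xl; apply: eq_ps.
by move=> f x _; apply: ps_le.
Qed.

Lemma group_le t' k : 0 < t' -> k < N -> (k %/ t').+1 <= (N %/ t').+1.
Proof. by move=> t0 kN; rewrite ltnS leq_div2r // ltnW. Qed.

Lemma eval_big2 e g : g <= (N %/ t1).+1 -> ev e = g %% W ->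
  ev (expr_big 2 e) = ps N v (g * t1) %% W.
Proof.
move=> gN Ee; have gc : g < big_count tau N by rewrite /big_count; lin.
by have := eval_big (isT : 2 < 4) gc Ee; rewrite /= alpha_val ?ps_le.
Qed.

(** The start is stored relative to the large group and cut to [omega] bits. In a sparse large group
    it may be truncated, but there [expr_group] takes its other side. *)
Lemma eval_start e h : h <= (N %/ t).+1 ->
    ps N v (h * t) - ps N v (h %/ (t * l) * t1) <= X1 -> ev e = h %% W ->
  ev (expr_start e) = ps N v (h * t) %% W.
Proof.
move=> hN hX Ee; have [E2 El _ _ _] := eval_params; have t4 := (grp2_ge4 tau2); have l0 := blk_gt0.
have hNN : N %/ t < N by apply: ltn_Pdiv => //; lin.
have tl1 : t1 = t * l * t by rewrite /grp1 /blk; lin.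
have tlt : t * l <= t1 by rewrite tl1 leq_pmulr //; lin.
have hg : h %/ (t * l) <= (N %/ t1).+1.
  have tl0 : 0 < t * l by rewrite muln_gt0 l0; lin.
  apply: leq_trans (leq_div2r _ hN) _.
  apply: (@leq_trans ((1 * (t * l) + N %/ t) %/ (t * l))); first by rewrite leq_div2r //; lin.
  by rewrite divnMDl // -divnMA add1n tl1 [t * l * t]mulnC.
have hW : h < W by lin.
have tlW : t * l < W by apply: leq_ltn_trans tlt grp1W.
have E1 := eval_big2 hg (eval_div Ee (eval_mul E2 El) hW tlW).
have E3 := eval_small (isT : 3 < 7) (small_index hN) Ee.
have := eval_add E1 E3; rewrite /= omega_val; last by rewrite (leq_trans hX) // leq_addr.
by rewrite subnKC // leq_ps // tl1 mulnA leq_mul2r leq_trunc_div orbT.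
Qed.

Lemma eval_near ek k e p : k < rk v N -> p <= ps N v k < p + l -> ev ek = k %% W ->
  ev e = (p %/ l) %% W -> ev (expr_near ek e) = ps N v k %% W.
Proof.
move=> kN /andP[pk kp] Ek Ee; have l0 := blk_gt0.
have pN : p < N by rewrite (leq_ltn_trans pk) // ps_lt.
have bN : p %/ l <= N %/ l by rewrite leq_div2r // ltnW.
have Ee1 := eval_add Ee (eval_cst w D a 1); rewrite addn1 in Ee1.
have Er := eval_rank_blk (_ : (p %/ l).+1 <= (N %/ l).+1) Ee1.
have kW : k < W by have := rk_leN N; lin.
have rW : rk v ((p %/ l).+1 * l) < W by have := rk_leN ((p %/ l).+1 * l); lin.
have lo : p %/ l * l <= p by rewrite leq_trunc_div.
have hi : p < (p %/ l).+1 * l by rewrite ltn_ceil.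
have := eval_cond (eval_lt_op Ek (Er bN) kW rW) (X := ps N v k) (Y := ps N v k).
rewrite if_same; apply => h.
  by apply: (eval_in_block kN _ Ek Ee); rewrite (leq_trans lo pk) ps_lt_rk.
apply: (eval_in_block kN _ Ek Ee1); move: h; rewrite -ps_lt_rk // -leqNgt => h.
by rewrite h (leq_trans kp) // [X in _ <= X]mulSn addnC leq_add2l ltnW.
Qed.

Lemma eval_far2 ek k e : let h := k %/ t in
    k < rk v N -> ps N v (h * t) + l <= ps N v (h.+1 * t) ->
    ps N v k <= ps N v (h * t) + X1 -> ev ek = k %% W ->
  ev e = (ps N v (h * t) %/ l) %% W -> ev (expr_far2 ek e) = ps N v k %% W.
Proof.
move=> h kN sp near Ek Ee; have l0 := blk_gt0; have t4 := (grp2_ge4 tau2).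
have [E2 El _ _ _] := eval_params.
have kW : k < W by have := rk_leN N; lin.
have t0 : 0 < t by lin.
set p := ps N v (h * t) in sp near Ee *; set b := p %/ l in Ee *.
have Em := eval_mod Ek E2 kW grp2W.
have km : k %% t < t by rewrite ltn_mod.
have ht : h * t <= k by rewrite leq_trunc_div.
have ic : b * t + k %% t < small_count tau N.
  have : b * t <= N %/ t.
    rewrite leq_divRL // -mulnA -/(blk tau).
    by apply: leq_trans (leq_trunc_div _ _) _; apply: ps_le.
  have : t <= 2 ^ l by have [tl _ _ _] := small_params; have := ltn_expl l (ltnSn 1); lin.
  have : 2 ^ l <= (l + 1) * (l + 1) * 2 ^ l by rewrite leq_pmull // muln_gt0 addn1.
  rewrite /small_count.
  move: (b * t) (N %/ t) (k %% t) km (2 ^ l) (_ * 2 ^ _) => z u q qt x y xy tx zu.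
  apply: (leq_ltn_trans (leq_add zu (ltnW qt))); rewrite -addnA ltn_add2l.
  by rewrite (leq_ltn_trans (leq_trans tx xy)) // addn3 ltnS leqW.
have := eval_small (isT : 4 < 7) ic (eval_add (eval_mul Ee E2) Em).
rewrite /= divnMDl // (divn_small km) addn0 modnMDl (modn_small km) /slot_one.
rewrite sparse_group //; last exact: leq_ltn_trans ht kN.
rewrite -divn_eq => E4; have := eval_add (eval_mul Ee El) E4.
have pk : b * l <= ps N v k by apply: leq_trans (leq_trunc_div _ _) _; apply: leq_ps.
rewrite omega_val ?subnKC // leq_subLR (leq_trans near) // addnCA addnC leq_add2l.
by rewrite addnC -mulSn ltnW // ltn_ceil.
Qed.

Lemma eval_dense ek e k : let h := k %/ t in let g := k %/ t1 in
    k < rk v N -> ps N v (g.+1 * t1) - ps N v (g * t1) < X1 ->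
    ev ek = k %% W -> ev e = h %% W ->
  ev (expr_dense ek e) = ps N v k %% W.
Proof.
move=> h g kN dense Ek Ee; have l0 := blk_gt0; have t4 := (grp2_ge4 tau2); have t0 : 0 < t by lin.
have [_ El _ _ _] := eval_params.
have kNN : k < N by apply: leq_trans kN (rk_leN N).
have hN := group_le t0 kNN; rewrite -/h in hN.
have tl1 : t1 = t * (t * l) by rewrite /grp1 /blk; lin.
have gE : h %/ (t * l) = g by rewrite -divnMA -tl1.
have tl0 : 0 < t * l by rewrite muln_gt0 t0.
have t10 : 0 < t1 by rewrite tl1 muln_gt0 t0.
have ht : h * t <= k by rewrite leq_trunc_div.
have hk : k < h.+1 * t by rewrite ltn_ceil.
have gk : k < g.+1 * t1 by rewrite ltn_ceil.
have hg1 : h.+1 * t <= g.+1 * t1.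
  by rewrite tl1 [t * (t * l)]mulnC mulnA leq_mul2r -gE ltn_ceil ?orbT.
have Es : ev (expr_start e) = ps N v (h * t) %% W.
  apply: eval_start => //; first exact: ltnW.
  rewrite gE; apply: ltnW; apply: leq_ltn_trans dense; apply: leq_sub2r; apply: leq_ps.
  by apply: ltnW; apply: leq_ltn_trans ht gk.
have Es1 : ev (expr_start (add e (Cst 1))) = ps N v (h.+1 * t) %% W.
  have Ee1 := eval_add Ee (eval_cst w D a 1); rewrite addn1 in Ee1.
  apply: (eval_start hN _ Ee1).
  have gg : g <= h.+1 %/ (t * l) by rewrite -gE leq_div2r.
  case: (ltngtP g (h.+1 %/ (t * l))) gg => // [gl|gl] _; last first.
    rewrite -gl; apply: ltnW; apply: leq_ltn_trans dense; apply: leq_sub2r; exact: leq_ps.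
  (* The next small group opens a new large group here, so its relative start is 0. *)
  have /eqP -> // : ps N v (h.+1 * t) - ps N v (h.+1 %/ (t * l) * t1) == 0.
  rewrite subn_eq0 leq_ps // (leq_trans hg1) // leq_mul2r gl orbT //.
have mono : ps N v (h * t) <= ps N v (h.+1 * t) by apply: leq_ps; rewrite leq_mul2r leqnSn orbT.
have pW j : ps N v j < W by rewrite (leq_ltn_trans (ps_le _ _ _)).
have Esub := eval_sub Es1 Es mono.
have Ed := eval_div Es El (pW _) blkW.
have subW : ps N v (h.+1 * t) - ps N v (h * t) < W by rewrite (leq_ltn_trans (leq_subr _ _)).
have := eval_cond (eval_lt_op Esub El subW blkW) (X := ps N v k) (Y := ps N v k).
have kp : ps N v k < ps N v (h.+1 * t) by apply: ltn_ps.
have pk : ps N v (h * t) <= ps N v k by apply: leq_ps.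
rewrite if_same; apply => sp.
  by apply: (eval_near kN _ Ek Ed); rewrite pk; move: sp; lin.
have h1 : ps N v k < ps N v (g.+1 * t1) by apply: ltn_ps.
have h2 : ps N v (g * t1) <= ps N v (h * t).
  by apply: leq_ps; rewrite -gE tl1 mulnCA mulnC leq_mul2r leq_trunc_div orbT.
apply: (eval_far2 kN _ _ Ek Ed); first by rewrite -leq_subRL // leqNgt.
apply: (leq_trans (ltnW h1)); apply: (leq_trans _ (leq_add h2 (leqnn X1))).
by rewrite -leq_subLR ltnW.
Qed.

Lemma eval_far1 ek k e : let g := k %/ t1 in
    k < rk v N -> ps N v (g * t1) + X1 <= ps N v (g.+1 * t1) -> ev ek = k %% W ->
  ev e = (ps N v (g * t1) %/ X1) %% W -> ev (expr_far1 ek e) = ps N v k %% W.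
Proof.
move=> g kN sp Ek Ee; have l0 := blk_gt0.
have [_ _ E1 _ _] := eval_params.
have kW : k < W by have := rk_leN N; lin.
have t10 : 0 < t1 by rewrite muln_gt0 l0.
have X10 : 0 < X1 by rewrite muln_gt0 t10.
set p := ps N v (g * t1) in sp Ee *.
have km : k %% t1 < t1 by rewrite ltn_mod.
have ic : p %/ X1 * t1 + k %% t1 < big_count tau N.
  have : p %/ X1 * t1 <= N %/ t1.
    rewrite leq_divRL // -mulnA -/(span1 tau).
    by apply: leq_trans (leq_trunc_div _ _) _; apply: ps_le.
  by rewrite /big_count; lin.
have := eval_big (isT : 3 < 4) ic (eval_add (eval_mul Ee E1) (eval_mod Ek E1 kW grp1W)).
rewrite /= divnMDl // (divn_small km) addn0 modnMDl (modn_small km) /slot_one.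
rewrite sparse_group //; last by apply: leq_ltn_trans kN; rewrite leq_trunc_div.
by rewrite -divn_eq alpha_val ?ps_le.
Qed.

Lemma eval_select e k : k < rk v N -> ev e = k %% W -> ev (expr_select e) = ps N v k %% W.
Proof.
move=> kN Ek; have l0 := blk_gt0; have t4 := (grp2_ge4 tau2).
have [E2 _ E1 EX _] := eval_params.
have kNN : k < N by apply: leq_trans kN (rk_leN N).
have kW : k < W by lin.
have t10 : 0 < t1 by rewrite muln_gt0 l0.
have Eg := eval_div Ek E1 kW grp1W.
set g := k %/ t1 in Eg *.
have gN : g.+1 <= (N %/ t1).+1 := group_le t10 kNN.
have Ea := eval_big2 (ltnW gN) Eg.
have Ea1 : ev (expr_big 2 (add (dvn e expr_grp1) (Cst 1))) = ps N v (g.+1 * t1) %% W.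
  have Eg1 := eval_add Eg (eval_cst w D a 1); rewrite addn1 in Eg1.
  exact: (eval_big2 gN Eg1).
have mono : ps N v (g * t1) <= ps N v (g.+1 * t1) by apply: leq_ps; rewrite leq_mul2r leqnSn orbT.
have pW j : ps N v j < W by rewrite (leq_ltn_trans (ps_le _ _ _)).
have subW : ps N v (g.+1 * t1) - ps N v (g * t1) < W by rewrite (leq_ltn_trans (leq_subr _ _)).
have := eval_cond (eval_lt_op (eval_sub Ea1 Ea mono) EX subW span1W)
  (X := ps N v k) (Y := ps N v k).
rewrite if_same; apply => sp.
  exact: (eval_dense kN sp Ek (eval_div Ek E2 kW grp2W)).
apply: (eval_far1 kN _ Ek (eval_div Ea EX (pW _) span1W)).
by rewrite -leq_subRL // leqNgt.
Qed.

End Queries.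

(** * Reduction to exact rank and select *)

Lemma rank_le b i B : rank b i B <= i.
Proof. by rewrite /rank (leq_trans (count_size _ _)) // size_take_min geq_minl. Qed.

Lemma rankD b i k B : rank b (i + k) B = rank b i B + rank b k (drop i B).
Proof. by rewrite /rank takeD count_cat. Qed.

Lemma rank_mono b i j B : i <= j -> rank b i B <= rank b j B <= rank b i B + (j - i).
Proof.
move=> ij; have -> : rank b j B = rank b i B + rank b (j - i) (drop i B).
  by rewrite -rankD subnKC.
by rewrite leq_addr leq_add2l rank_le.
Qed.

Lemma rank_oversize b i B : size B <= i -> rank b i B = count_mem b B.
Proof. by move=> sB; rewrite /rank take_oversize. Qed.

Lemma positions_rcons b B x : positions b (rcons B x) =
  positions b B ++ (if x == b then [:: (size B).+1] else [::]).
Proof.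
rewrite /positions size_rcons -[in LHS](addn1 (size B)) iotaD filter_cat add1n /=.
rewrite nth_rcons ltnn eqxx.
congr (_ ++ _); apply: eq_in_filter => p; rewrite mem_iota add1n => /andP[p1 pB].
by rewrite nth_rcons; case: p p1 pB => //= p _; rewrite ltnS => ->.
Qed.

Lemma size_positions b B : size (positions b B) = count_mem b B.
Proof.
elim/last_ind: B => [|B x IHB] //; rewrite positions_rcons size_cat IHB -cats1 count_cat /=.
by case: eqP.
Qed.

Lemma select_le b i p B : i <= count_mem b B -> (select b i B <= p) = (i <= rank b p B).
Proof.
case: i => [|i] //; rewrite /select /=.
elim/last_ind: B i p => [|B x IHB] i p //.
rewrite -cats1 count_cat /= addn0 cats1 positions_rcons => iB.
have rE : rank b p (rcons B x) = if p <= size B then rank b p B else count_mem b B + (x == b).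
  rewrite -cats1 /rank take_cat; case: ltngtP => // h.
  - by rewrite take_oversize ?count_cat /= ?addn0 // subn_gt0.
  - by rewrite h subnn take0 cats0 take_size.
rewrite rE nth_cat size_positions; case: ltnP => iC.
  rewrite IHB //; case: (leqP p (size B)) => // pB.
  by rewrite rank_oversize ?(ltnW pB) // iC (leq_trans iC) ?leq_addr.
have xb : (x == b) = true by move: iB; case: (x == b) => //; rewrite addn0 ltnNge iC.
rewrite xb addn1 ltnS in iB *.
have -> : i = count_mem b B by apply/eqP; rewrite eqn_leq iB iC.
rewrite subnn /=; case: (leqP p (size B)) => pB; last by rewrite leqnn.
have := rank_mono b B pB; rewrite (rank_oversize b (leqnn (size B))) => /andP[h _].
by rewrite (ltnNge (count_mem b B)) h.
Qed.

Section Reduction.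
Variables (B : bitseq) (d : nat).
Hypothesis d0 : 0 < d.

Definition crossing (j : nat) : bool := rank true (j * d) B %/ d < rank true (j.+1 * d) B %/ d.

(** A cell has [d] positions, so the quotient grows by at most 1 over it and a single bit records
    the growth. *)
Lemma rk_crossing j : rk crossing j = rank true (j * d) B %/ d.
Proof.
elim: j => [|j IHj]; first by rewrite rk0 mul0n /rank take0 div0n.
rewrite rkS IHj /crossing mulSn [d + _]addnC.
have /andP[h1 h2] := rank_mono true B (leq_addr d (j * d)).
rewrite addKn in h2; set x := rank true (j * d) B in h1 h2 *; set y := rank _ _ _ in h1 h2 *.
have l1 : x %/ d <= y %/ d by rewrite leq_div2r.
have l2 : y %/ d <= (x %/ d).+1.
  by rewrite (leq_trans (leq_div2r d h2)) // divnDr // divnn d0 addn1.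
by move: (x %/ d) (y %/ d) l1 l2 => p q; case: ltnP; lia.
Qed.

Lemma crossing_oversize N : size B <= N * d -> forall j, N <= j -> crossing j = false.
Proof.
move=> BN j Nj; have h : N * d <= j * d by rewrite leq_mul2r Nj orbT.
rewrite /crossing !rank_oversize ?ltnn ?(leq_trans BN) //.
by rewrite mulSn (leq_trans h) // leq_addl.
Qed.

(** Let [s = i %% d] and let [p] be the quotient at the start of the cell. Without a crossing the
    rank stays in [[d * p, d * p + d)]. With one, at most [d - s] ones follow in the cell, so the
    rank is at least [d * p + s]; at most [s] precede, so it is below [d * p + d + s]. *)
Lemma drankA_correct i : let j := i %/ d in
  is_drankA true i B d (d * rk crossing j + (rk crossing j.+1 - rk crossing j) * (i %% d)).
Proof.
move=> j; have im : i %% d < d by rewrite ltn_mod.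
have iE := divn_eq i d; rewrite -/j in iE.
rewrite rkS addKn /crossing !rk_crossing /is_drankA.
have lo : j * d <= i by rewrite leq_trunc_div.
have hi : i <= j.+1 * d by rewrite ltnW // ltn_ceil.
have /andP[a1 a2] := rank_mono true B lo; have /andP[b1 b2] := rank_mono true B hi.
set x := rank true (j * d) B in a1 a2 *; set y := rank true (j.+1 * d) B in b1 b2 *.
set z := rank true i B in a1 a2 b1 b2 *.
have xE := divn_eq x d; have xm : x %% d < d by rewrite ltn_mod.
have yE := divn_eq y d; have ym : y %% d < d by rewrite ltn_mod.
move: (i %% d) im iE (x %/ d) (x %% d) (y %/ d) (y %% d) xE xm yE ym => s sd iE p r q u xE xm yE ym.
clearbody x y z j; case: (ltnP p q) => pq; rewrite ?mul1n ?mul0n ?addn0.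
  have : p.+1 * d <= q * d by rewrite leq_mul2r pq orbT.
  by rewrite mulSn [d * p]mulnC; move: b2; rewrite iE mulSn; lia.
have : q * d <= p * d by rewrite leq_mul2r pq orbT.
by rewrite [d * p]mulnC; lia.
Qed.

Lemma crossing_ones N : size B <= N * d -> rk crossing N = count_mem true B %/ d.
Proof. by move=> BN; rewrite rk_crossing rank_oversize. Qed.

(** For [i < d] the lower bound is [select 0 = 0], and the [i]-th one is not before position [i].
    Otherwise write [i = q * d + s]; in the cell [p] of the [q]-th crossing the rank passes [q * d],
    which forces [i - d <= rank (p * d + s) < i]. *)
Lemma selectA_correct N i : size B <= N * d -> 0 < i <= count_mem true B ->
  is_selectA true i B d
    (if i < d then i else ps N crossing (i %/ d - 1) * d + i %% d + 1).
Proof.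
move=> BN /andP[i0 im]; rewrite /is_selectA.
have im' : i - d <= count_mem true B by rewrite (leq_trans (leq_subr _ _)).
case: (ltnP i d) => id.
  have -> : i - d = 0 by apply/eqP; rewrite subn_eq0 ltnW.
  split=> //; rewrite leqNgt -{2}(prednK i0) ltnS select_le // -ltnNge.
  by rewrite -{2}(prednK i0) ltnS rank_le.
set q := i %/ d; set s := i %% d.
have q0 : 0 < q by rewrite divn_gt0.
have sd : s < d by rewrite ltn_mod.
have iE : i = q * d + s by rewrite -divn_eq.
have kN : q - 1 < rk crossing N.
  by rewrite (crossing_ones BN) subn1 prednK // leq_div2r.
set p := ps N crossing (q - 1).
have e1 := rk_ps kN; have e2 := one_ps kN; rewrite -/p in e1 e2.
have e3 := rkS crossing p; rewrite e1 e2 addn1 subn1 prednK // in e3.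
rewrite !rk_crossing in e1 e3.
have h1 : rank true (p * d) B < q * d.
  by rewrite -ltn_divLR // e1; lia.
have h2 : q * d <= rank true (p.+1 * d) B by rewrite -leq_divRL // e3.
have /andP[_ a2] := rank_mono true B (leq_addr s (p * d)).
have pd : p * d + s <= p.+1 * d by rewrite mulSn addnC leq_add2r ltnW.
have /andP[_ b2] := rank_mono true B pd.
rewrite addn1 ltnS ltnNge !select_le //.
move: (rank _ _ _) (rank _ _ _) (rank _ _ _) h1 h2 a2 b2 => x y z.
rewrite mulSn iE; move: (p * d) (q * d) => pd' qd; lia.
Qed.

End Reduction.

(** * Choice of the parameters and size of the directories *)

(** As [blk tau = 4 ^ tau], this is the largest [tau] with [4 * blk tau <= lg N], unless the floor 2
    intervenes; the tables then have about [N ^ (1/4)] entries up to logarithmic factors. *)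
Definition tau_of (N : nat) : nat := maxn 2 (trunc_log 4 (trunc_log 2 N %/ 4)).
Definition alpha_of (N : nat) : nat := (trunc_log 2 N).+1.

(* Everything but the information-theoretic part of the payload, plus the slack
   [2 * alpha_of N] that absorbs the rounding of the binomial coefficient. *)
Definition redundancy (N : nat) : nat :=
  base3 (tau_of N) (alpha_of N) N + (N %/ blk (tau_of N) + blk (tau_of N)) + 2 * alpha_of N.

Lemma tau_of_ge2 N : 2 <= tau_of N. Proof. exact: leq_maxl. Qed.

Lemma ltn_alpha_of N : N < 2 ^ alpha_of N. Proof. exact: trunc_log_ltn. Qed.

Lemma expn4_blk k : 4 ^ k = blk k.
Proof. by rewrite blkE expnM. Qed.

Lemma alpha_of_le N : alpha_of N <= 16 * blk (tau_of N).
Proof.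
have h : trunc_log 2 N %/ 4 < 4 ^ (tau_of N).+1.
  apply: leq_trans (trunc_log_ltn _ (isT : 1 < 4)) _.
  by rewrite leq_exp2l // ltnS leq_maxr.
move: h; rewrite ltn_divLR // expnS expn4_blk /alpha_of; lia.
Qed.

Lemma tau_of_large N : 0 < N -> 2 < tau_of N -> 2 ^ (4 * blk (tau_of N)) <= N.
Proof.
move=> N0; rewrite /tau_of; set k := trunc_log 4 _ => h.
have -> : maxn 2 k = k by lia.
have k0 : 0 < k by lia.
have x0 : 0 < trunc_log 2 N %/ 4 by move: k0; rewrite /k; case: (_ %/ 4).
have := trunc_logP (isT : 1 < 4) x0; rewrite -/k expn4_blk leq_divRL // mulnC => h4.
by apply: leq_trans (trunc_logP (isT : 1 < 2) N0); rewrite leq_exp2l.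
Qed.

Lemma tau_of_unbounded K : exists N1, forall N, N1 <= N -> K <= tau_of N.
Proof.
exists (2 ^ (4 ^ K * 4)) => N h; apply: leq_trans (leq_maxr _ _).
apply: trunc_log_max => //; rewrite leq_divRL //.
exact: trunc_log_max.
Qed.

(** A redundancy of order [N / tau] suffices, since [tau] is unbounded. The term [q2 * tau] of the
    small records is absorbed by [tau * tau <= 2 * t], the tables by [Y * Y <= N]. The five parts
    cost 4, 256, 680, 2 and 32 times [N], below 1000. *)
Lemma redundancy_arith N t l tau al Y q1 q2 q3 :
    l = t * t -> 8 <= t -> tau * tau <= 2 * t -> tau <= t -> al <= 16 * l ->
    l * l * (l * l) <= Y -> Y * Y <= N -> q1 * (l * l) <= N -> q2 * t <= N -> q3 * l <= N ->
  (4 * l + 4 * (q1 + l * l + 3) * al + 7 * (q2 + (l + 1) * (l + 1) * Y + 3) * (16 * tau)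
   + (q3 + l) + 2 * al) * tau <= 1000 * N.
Proof.
move=> lE t8 tt taut all lY YN h1 h2 h3.
have tl : t <= l by rewrite lE leq_pmulr //; lia.
have taul : tau <= l by lia.
have l64 : 64 <= l by rewrite lE (leq_mul t8 t8).
have ll : l <= l * l by rewrite leq_pmulr //; lia.
have l4 : l * l <= l * l * (l * l) by rewrite leq_pmulr //; lia.
have YY : Y <= Y * Y by rewrite leq_pmulr //; lia.
have llN : l * l <= N by lia.
have A : 4 * l * tau <= 4 * N.
  by rewrite -mulnA leq_mul2l /= (leq_trans _ llN) // leq_mul2l taul orbT.
have B : 4 * (q1 + l * l + 3) * al * tau <= 256 * N.
  apply: (@leq_trans (4 * (q1 + l * l + 3) * (16 * l) * l)).
    by rewrite leq_mul // leq_mul2l all orbT.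
  have -> : 4 * (q1 + l * l + 3) * (16 * l) * l
    = 64 * (q1 * (l * l)) + 64 * (l * l * (l * l)) + 192 * (l * l) by lia.
  have : 192 * (l * l) <= 3 * (l * l * (l * l)) by nia.
  lia.
have C : 7 * (q2 + (l + 1) * (l + 1) * Y + 3) * (16 * tau) * tau <= 680 * N.
  have -> : 7 * (q2 + (l + 1) * (l + 1) * Y + 3) * (16 * tau) * tau
    = 112 * ((q2 + (l + 1) * (l + 1) * Y + 3) * (tau * tau)) by lia.
  apply: (@leq_trans (112 * ((q2 + (l + 1) * (l + 1) * Y + 3) * (2 * t)))).
    by rewrite leq_mul2l /= leq_mul2l tt orbT.
  have c1 : ((l + 1) * (l + 1) * Y + 3) * t <= 2 * N.
    apply: (@leq_trans (2 * (l * l) * Y * l)).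
      apply: leq_mul => //; have : (l + 1) * (l + 1) + 3 <= 2 * (l * l) by nia.
      nia.
    have : l * l * l <= Y by nia.
    nia.
  nia.
have D : (q3 + l) * tau <= 2 * N.
  rewrite mulnDl (_ : 2 * N = N + N); last by lia.
  by apply: leq_add; [apply: leq_trans h3|apply: leq_trans llN]; rewrite leq_mul2l taul orbT.
have E : 2 * al * tau <= 32 * N.
  by apply: (@leq_trans (32 * l * l)); [apply: leq_mul => //; lia|lia].
by rewrite !mulnDl; lia.
Qed.

Lemma redundancy_le : exists K, forall N, 0 < N -> 2 < tau_of N ->
  redundancy N * tau_of N <= K * N.
Proof.
exists 1000 => N N0 t3; have t2 := tau_of_ge2 N; have al := alpha_of_le N.
have large := tau_of_large N0 t3.
rewrite /redundancy; move: (alpha_of N) al => alpha al.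
move: (tau_of N) t3 t2 al large => tau t3 t2 al large.
have sp := span1_le t2; have tb := tau_blk t2.
have tlt : tau < 2 ^ tau by apply: ltn_expl.
have sq : tau * tau <= 2 * 2 ^ tau.
  clear -t3; elim: tau t3 => // [[|[|[|k]]]] IHk _ //.
  by have := IHk isT; rewrite !expnS; nia.
apply: (@redundancy_arith N (grp2 tau) (blk tau) tau alpha (2 ^ blk tau)) => //.
- by rewrite -[8]/(2 ^ 3) leq_exp2l.
- exact: ltnW.
- by apply: leq_trans large; rewrite -expnD leq_exp2l //; lia.
- exact: leq_trunc_div.
- exact: leq_trunc_div.
- exact: leq_trunc_div.
Qed.

(** The threshold must work for every number [N <= n] of cells, however small: for large [N] the
    redundancy is at most [N], and the finitely many others are covered by a maximum. *)
Lemma word_large (w : nat -> nat) : (forall n, n < 2 ^ w n) ->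
  exists n0, forall n N, n0 <= n -> 0 < N <= n ->
    [/\ 0 < n0, redundancy N <= n & 4 * blk (tau_of N) <= w n].
Proof.
move=> wfit; have [K HK] := redundancy_le.
have [N1 HN1] := tau_of_unbounded (maxn 3 K).
(* Here [x] is 64; it is kept opaque so that the unary number [2 ^ x] is never computed. *)
have [x xE] : exists x, x = 4 * blk 2 by eexists.
exists (maxn (maxn 1 (2 ^ x)) (\max_(N < N1) redundancy N)) => n N.
rewrite !geq_max => /andP[/andP[n1 nx] nG] /andP[N0 Nn]; split.
- by rewrite !leq_max.
- case: (leqP N1 N) => h; last first.
    by apply: leq_trans nG; apply: (leq_bigmax_cond (Ordinal h)).
  have := HN1 _ h; rewrite geq_max => /andP[t3 tK].
  have := HK _ N0 t3; case: (posnP K) => [->|K0].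
    by rewrite mul0n leqn0 muln_eq0 => /orP[/eqP->|/eqP t0] //; move: t3; rewrite t0.
  move=> hh; apply: leq_trans Nn; rewrite -(leq_pmul2l K0).
  by apply: leq_trans hh; rewrite mulnC leq_mul2l tK orbT.
- rewrite ltnW // -(@ltn_exp2l 2) //.
  case: (ltnP 2 (tau_of N)) => t3.
    exact: leq_ltn_trans (leq_trans (tau_of_large N0 t3) Nn) (wfit n).
  have -> : tau_of N = 2 by apply/eqP; rewrite eqn_leq t3 tau_of_ge2.
  by rewrite -xE (leq_ltn_trans nx).
Qed.

(** * The data structure *)

(** A halted state is a fixed point of [step]; this gives both programs a common time bound. *)
Lemma computes_halted w D P T T' args Q : T <= T' -> computes w D P T args Q ->
  computes w D P T' args Q.
Proof.
move=> TT [hlt HQ]; rewrite /computes -(subnK TT) iterD.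
set s := iter T _ _ in hlt HQ *.
suff -> : iter (T' - T) (step w D P) s = s by [].
elim: (T' - T) => //= k ->; rewrite /step.
suff -> : onth P (pc s) = None by [].
by clearbody s; elim: P (pc s) hlt {HQ} => [|c P IHP] [|j] //=; apply: IHP.
Qed.

(* The comparisons are made for increasing [k]: as [k] is reduced modulo the word
   size, a larger constant could be mistaken for [n]. *)
Fixpoint by_length (f : nat -> expr) (k m : nat) (rest : expr) : expr :=
  if m is m'.+1 then cond (eqx arg_n (Cst k)) (f k) (by_length f k.+1 m' rest) else rest.

Lemma eval_by_length w D a f k m rest n : a 1 = n -> n < 2 ^ w -> k <= n ->
    (forall j, a j < 2 ^ w) ->
  eval w D a (by_length f k m rest) = eval w D a (if n < k + m then f n else rest).
Proof.
move=> an nW kn aW; have lt := @eval_lt w D a _ aW.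
have En : eval w D a arg_n = n %% 2 ^ w by rewrite /eval /= an modn_small.
elim: m k kn => [|m IHm] k kn; first by rewrite addn0 ltnNge kn.
rewrite /= addnS; have kW := leq_ltn_trans kn nW.
have := eval_cond (eval_eq_op En (eval_cst w D a k) nW kW)
  (X := eval w D a (f k)) (Y := eval w D a (by_length f k.+1 m rest)).
case: eqP => [<-|/eqP nk] ->; rewrite ?(modn_small (lt _)) //.
  by rewrite ltnS leq_addr.
have kn' : k < n by rewrite ltn_neqAle eq_sym nk.
by rewrite IHm // addSn.
Qed.

(** The position of the [i]-th one is the number of [k >= 0] with [rank k < i], a sum that can be
    unrolled for bounded lengths. *)
Fixpoint count_below (k : nat) : expr :=
  if k is k'.+1 then add (count_below k') (ltx (Peek (Cst k')) arg_i) else Cst 0.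

Definition small_structure (w n : nat) (B : bitseq) : bitseq :=
  bits_array w n.+1 (fun i => rank true i B).

Lemma memory_small w n B i : n < 2 ^ w -> i <= n ->
  memory w (small_structure w n B) i = rank true i B.
Proof.
move=> nW iN; rewrite memoryE.
have := @bits_val_array [::] [::] w n.+1 (fun i => rank true i B) i iN.
rewrite cats0 /= add0n => ->; rewrite modn_small //.
by rewrite (leq_ltn_trans (rank_le _ _ _)) // (leq_ltn_trans iN).
Qed.

Lemma eval_count_below w n B a i k : n < 2 ^ w -> size B = n -> k <= n ->
    a 0 = i -> 0 < i <= count_mem true B ->
  eval w (small_structure w n B) a (count_below k) = minn k (select true i B) %% 2 ^ w.
Proof.
move=> nW sB kn ai /andP[i0 im].
have iW : i < 2 ^ w by rewrite (leq_ltn_trans im) // (leq_ltn_trans (count_size _ _)) ?sB.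
have Ei : eval w (small_structure w n B) a arg_i = i %% 2 ^ w.
  by rewrite /eval /= ai modn_small.
elim: k kn => [|k IHk] kn; first by rewrite min0n.
have kW : k < 2 ^ w by apply: ltn_trans kn nW.
have Er := eval_fetch (eval_cst w (small_structure w n B) a k) kW.
rewrite memory_small ?(ltnW kn) // in Er.
have rW : rank true k B < 2 ^ w by rewrite (leq_ltn_trans (rank_le _ _ _)).
have := eval_add (IHk (ltnW kn)) (eval_lt_op Er Ei rW iW) => /= ->.
congr (_ %% _); rewrite ltnNge -select_le // -ltnNge /minn.
by move: (select _ _ _) => s; case: (ltnP k s); case: (ltnP k.+1 s); lia.
Qed.

Definition main_rank : expr :=
  let j := dvn arg_i arg_d in
  add (mul arg_d (expr_rank j))
      (mul (mdn arg_i arg_d) (sub (expr_rank (add j (Cst 1))) (expr_rank j))).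

Definition main_select : expr :=
  cond (ltx arg_i arg_d) arg_i
    (add (add (mul (expr_select (sub (dvn arg_i arg_d) (Cst 1))) arg_d) (mdn arg_i arg_d))
         (Cst 1)).

Definition trivial_flag : expr := mdn (Peek (Cst 0)) (Cst 2).

(** The flag means [n < delta]: every rank is then below the allowed error, so 0 is a valid answer,
    as is position 1 for select. *)
Definition query_rank (n0 : nat) : expr :=
  by_length (fun=> Peek arg_i) 0 n0 (cond trivial_flag (Cst 0) main_rank).

Definition query_select (n0 : nat) : expr :=
  by_length count_below 0 n0 (cond trivial_flag (Cst 1) main_select).

Definition cells (n d : nat) : nat := n.-1 %/ d + 1.

(* For [n < d] the machine only sees [d] modulo [2 ^ w], so that this case is signalled
   by the first bit, which is 0 in a [layout]. *)
Definition encoding (w : nat -> nat) (n0 n d : nat) (B : n.-tuple bool) : bitseq :=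
  if n < n0 then small_structure (w n) n B
  else if n < d then [:: true]
  else layout (tau_of (cells n d)) (alpha_of (cells n d)) (cells n d) (crossing B d).

Lemma cells_cover n d : 0 < n -> 0 < d -> n <= cells n d * d.
Proof. by move=> n0 d0; rewrite /cells addn1 -{1}(prednK n0) ltn_ceil. Qed.

Lemma cells_le n d : 0 < n -> 0 < cells n d <= n.
Proof. by move=> n0; rewrite /cells addn1 /= -{2}(prednK n0) ltnS leq_div. Qed.

(** * Correctness for long strings *)

Section Correctness.
Variables (w : nat -> nat) (n0 : nat).
Hypothesis w_fits : forall n, n < 2 ^ w n.
Hypothesis n0_large : forall n N, n0 <= n -> 0 < N <= n ->
    [/\ 0 < n0, redundancy N <= n & 4 * blk (tau_of N) <= w n].

Section Main.
Variables (n d i : nat) (B : n.-tuple bool).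
Hypotheses (n_gt0 : 0 < n) (d_gt0 : 0 < d) (n_ge : n0 <= n) (dn : d <= n) (iN : 0 < i <= n).
Local Notation W := (2 ^ w n).
Local Notation N := (cells n d).
Local Notation tau := (tau_of N).
Local Notation alpha := (alpha_of N).
Local Notation v := (crossing B d).
Local Notation a := (regs (w n) [:: i; n; d; w n]).
Local Notation ev := (eval (w n) (layout tau alpha N v) a).

Lemma main_args : [/\ ev arg_i = i %% W, ev arg_n = n %% W, ev arg_d = d %% W & a 3 = w n].
Proof. by split=> //; rewrite /regs /= modn_small // ltn_expl. Qed.

Lemma main_bounds : [/\ i < W, n < W & d < W].
Proof.
have nW := w_fits n; case/andP: iN => _ i_n.
by split=> //; [apply: leq_ltn_trans nW | apply: leq_ltn_trans nW].
Qed.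

Lemma main_hypotheses : [/\ ev expr_N = N %% W, alpha <= w n, alpha < 2 ^ blk tau
  & base3 tau alpha N < W].
Proof.
have [Ei En Ed aw] := main_args; have [iW nW dW] := main_bounds.
have Nn := cells_le d n_gt0; have [_ red lw] := n0_large n_ge Nn.
have /andP[N_gt0 N_le] := Nn.
split.
- apply: (eval_add _ (eval_cst _ _ _ 1)); apply: (eval_div _ Ed) => //.
    by rewrite -subn1; apply: (eval_sub En (eval_cst _ _ _ 1)).
  exact: leq_ltn_trans (leq_pred n) nW.
- rewrite /alpha_of -(@ltn_exp2l 2) //; apply: leq_ltn_trans (leq_ltn_trans N_le nW).
  exact: trunc_logP.
- apply: leq_ltn_trans (alpha_of_le N) _.
  have := span1_le (tau_of_ge2 N); apply: leq_trans.
  have := grp2_ge4 (tau_of_ge2 N); rewrite /span1 /grp1 /blk; move: (grp2 _) => t t4.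
  have : 16 <= t * t by nia.
  move: (t * t) => l l16; have : 16 * l <= l * l by rewrite leq_mul2r l16 orbT.
  nia.
- apply: leq_ltn_trans nW; apply: leq_trans red; rewrite /redundancy -addnA; exact: leq_addr.
Qed.

Lemma main_rank_eval j e : j <= N -> ev e = j %% W -> ev (expr_rank e) = rk v j %% W.
Proof.
have [_ _ _ aw] := main_args; have [EN al alY bW] := main_hypotheses.
have Nn := cells_le d n_gt0; have [_ _ lw] := n0_large n_ge Nn; have [_ nW _] := main_bounds.
have /andP[N_gt0 N_le] := Nn.
apply: eval_rank => //; [exact: tau_of_ge2|exact: leq_ltn_trans nW|exact: ltn_alpha_of|].
by apply: crossing_oversize; rewrite size_tuple cells_cover.
Qed.

Lemma main_select_eval k e : k < rk v N -> ev e = k %% W -> ev (expr_select e) = ps N v k %% W.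
Proof.
have [_ _ _ aw] := main_args; have [EN al alY bW] := main_hypotheses.
have Nn := cells_le d n_gt0; have [_ _ lw] := n0_large n_ge Nn; have [_ nW _] := main_bounds.
have /andP[N_gt0 N_le] := Nn.
apply: eval_select => //; [exact: tau_of_ge2|exact: leq_ltn_trans nW|exact: ltn_alpha_of|].
by apply: crossing_oversize; rewrite size_tuple cells_cover.
Qed.

Lemma main_flag : ev trivial_flag = false %% W.
Proof.
have [_ _ _ aw] := main_args; have [EN al alY bW] := main_hypotheses.
have Nn := cells_le d n_gt0; have [_ _ lw] := n0_large n_ge Nn; have [_ nW _] := main_bounds.
have [j mE] := head_word N v lw (tau_of_ge2 N) alY.
have W2 : 2 < W.
  have t4 := grp2_ge4 (tau_of_ge2 N); have b1 : 1 < w n by move: lw; rewrite /blk; nia.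
  by apply: leq_trans (_ : 2 ^ 2 <= _) => //; rewrite leq_exp2l.
have h := eval_mod (eval_fetch (eval_cst (w n) (layout tau alpha N v) a 0) _)
  (eval_cst _ _ _ 2) (memory_lt _ _ _) W2.
rewrite /trivial_flag h ?expn_gt0 //; congr (_ %% _); rewrite mE modn2 oddM oddX orbF.
by rewrite blkE -?lt0n expn_eq0.
Qed.

Lemma main_rank_correct : is_drankA true i B d (ev main_rank).
Proof.
have [Ei En Ed _] := main_args; have [iW nW dW] := main_bounds.
have := drankA_correct B d_gt0 i => /=; set r := (_ + _); move=> Hr.
suff -> : ev main_rank = r by [].
have rW : r < W.
  case: Hr => _ h; apply: leq_ltn_trans h _; apply: leq_ltn_trans (rank_le _ _ _) _.
  exact: iW.
rewrite -(modn_small rW) /r /main_rank.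
have Ej := eval_div Ei Ed iW dW; have Es := eval_mod Ei Ed iW dW.
have iE := divn_eq i d; case/andP: iN => i_gt0 i_n.
have cov : i <= N * d := leq_trans i_n (cells_cover n_gt0 d_gt0).
have jN : i %/ d <= N by rewrite -(mulnK N d_gt0) leq_div2r.
have Er := main_rank_eval jN Ej.
rewrite [_ * (i %% d)]mulnC; apply: (eval_add (eval_mul Ed Er)).
(* If [d] divides [i], the index [i %/ d + 1] may exceed [N], where nothing is known about the rank
   expression; the factor 0 hides it. *)
have [s0|s_gt0] := posnP (i %% d).
  by rewrite s0 in Es *; rewrite mul0n; apply: eval_mul0.
apply: (eval_mul Es); apply: (eval_sub _ Er); last by apply: leq_rk.
have Ej1 := eval_add Ej (eval_cst _ _ _ 1); rewrite addn1 in Ej1.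
apply: main_rank_eval Ej1; rewrite ltn_divLR // ltn_neqAle cov andbT.
by apply/eqP => iNd; move: s_gt0; rewrite iNd modnMl.
Qed.

Lemma main_select_correct : i <= count_mem true B -> is_selectA true i B d (ev main_select).
Proof.
move=> im; have [Ei En Ed _] := main_args; have [iW nW dW] := main_bounds.
case/andP: iN => i_gt0 i_n.
have cov : size B <= N * d by rewrite size_tuple cells_cover.
have := @selectA_correct B d d_gt0 N i cov; rewrite i_gt0 im => /(_ isT).
set p := (X in is_selectA _ _ _ _ X); move=> Hp.
suff -> : ev main_select = p by [].
have pW : p < W.
  case: Hp => _ h; apply: leq_ltn_trans h _; apply: leq_ltn_trans nW.
  by rewrite select_le // rank_oversize ?size_tuple.
rewrite -(modn_small pW) /p; apply: eval_cond; first exact: eval_lt_op.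
  by move=> _.
rewrite -leqNgt => di.
have Ej := eval_div Ei Ed iW dW; have Es := eval_mod Ei Ed iW dW.
have j0 : 0 < i %/ d by rewrite divn_gt0.
apply: (eval_add _ (eval_cst _ _ _ 1)); apply: (eval_add _ Es); apply: (eval_mul _ Ed).
apply: main_select_eval; last exact: (eval_sub Ej (eval_cst _ _ _ 1)).
by rewrite (crossing_ones d_gt0 cov) subn1 prednK // leq_div2r.
Qed.

End Main.
End Correctness.

Lemma supports_encoding w n0 (w_fits : forall n, n < 2 ^ w n)
    (n0_large : forall n N, n0 <= n -> 0 < N <= n ->
       [/\ 0 < n0, redundancy N <= n & 4 * blk (tau_of N) <= w n])
    n d (B : n.-tuple bool) : 0 < n -> 0 < d ->
  supports (w n) (program_of (query_rank n0)) (program_of (query_select n0))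
    (size (program_of (query_rank n0)) + size (program_of (query_select n0)))
    d B (encoding w n0 d B).
Proof.
move=> n_gt0 d_gt0; have nW := w_fits n.
have flag1 i : n0 <= n ->
    eval (w n) [:: true] (regs (w n) [:: i; n; d; w n]) trivial_flag = true %% 2 ^ w n.
  move=> n_ge; have [_ _ lw] := n0_large n 1 n_ge n_gt0.
  have w1 : 1 < w n.
    by apply: leq_trans lw; have := tau_blk (tau_of_ge2 1); have := tau_of_ge2 1; lia.
  have W2 : 2 < 2 ^ w n by apply: leq_trans (_ : 2 ^ 2 <= _) => //; rewrite leq_exp2l.
  have h := eval_mod (eval_fetch (eval_cst (w n) [:: true] (regs (w n) [:: i; n; d; w n]) 0) _)
    (eval_cst _ _ _ 2) (memory_lt _ _ _) W2.
  rewrite /trivial_flag h ?expn_gt0 //; congr (_ %% _).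
  rewrite /memory -(prednK (ltnW w1)) big_ord_recl /= big1 => [|k _]; first by [].
  by rewrite nth_nil.
split=> i /andP[i_gt0 i_le].
- apply: (computes_halted (leq_addr _ _)); apply: computes_program_of.
  rewrite /query_rank (@eval_by_length _ _ _ _ _ _ _ n) ?add0n //; last exact: regs_lt.
    rewrite /encoding; case: (ltnP n n0) => n_ge.
      have -> : eval (w n) (small_structure (w n) n B) (regs (w n) [:: i; n; d; w n]) (Peek arg_i)
        = rank true i B.
        have iW := leq_ltn_trans i_le nW.
        rewrite (@eval_fetch _ _ _ arg_i i) // memory_small // modn_small //.
        exact: leq_ltn_trans (rank_le _ _ _) iW.
      by rewrite /is_drankA -[X in X < _]addn0 ltn_add2l.
    case: (ltnP n d) => nd.
      rewrite (eval_cond (flag1 i n_ge) (X := 0) (Y := 0)) // mod0n /is_drankA add0n.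
      by split=> //; apply: leq_ltn_trans nd; apply: leq_trans (rank_le _ _ _) _.
    set a := regs _ _; set D := layout _ _ _ _.
    have iN : 0 < i <= n by rewrite i_gt0.
    have mW : eval (w n) D a main_rank < 2 ^ w n by apply: eval_lt; apply: regs_lt.
    have Ef : eval (w n) D a trivial_flag = false %% 2 ^ w n by apply: (@main_flag _ n0).
    rewrite (eval_cond Ef (X := 0) (Y := eval (w n) D a main_rank)) ?modn_small ?expn_gt0 //.
    exact: (@main_rank_correct _ n0).
  by rewrite /regs /= modn_small.
- have i_n : i <= n by rewrite (leq_trans i_le) // (leq_trans (count_size _ _)) ?size_tuple.
  apply: (computes_halted (leq_addl _ _)); apply: computes_program_of.
  rewrite /query_select (@eval_by_length _ _ _ _ _ _ _ n) ?add0n //; last exact: regs_lt.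
    rewrite /encoding; case: (ltnP n n0) => n_ge.
      rewrite (eval_count_below (i := i)) ?size_tuple ?i_gt0 //; last first.
        by rewrite /regs /= modn_small // (leq_ltn_trans i_n).
      have sn : select true i B <= n by rewrite select_le // rank_oversize ?size_tuple.
      have -> : minn n (select true i B) = select true i B by apply/minn_idPr.
      rewrite modn_small ?(leq_ltn_trans sn) // /is_selectA; split=> //.
      have s_gt0 : 0 < select true i B by rewrite ltnNge select_le // -ltnNge /rank take0.
      have ri : i <= rank true (select true i B) B by rewrite -select_le.
      have /andP[_ step1] := rank_mono true B (leq_pred (select true i B)).
      rewrite -(prednK s_gt0) ltnS select_le; last by rewrite (leq_trans (leq_subr _ _)).
      by move: (rank _ _ _) (rank _ _ _) ri step1 => x y; move: (select _ _ _) s_gt0 => z; lia.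
    case: (ltnP n d) => nd.
      rewrite (eval_cond (flag1 i n_ge) (X := 1) (Y := 0)) // modn_small; last first.
        by rewrite (leq_ltn_trans n_gt0).
      rewrite /is_selectA.
      have -> : i - d = 0 by apply/eqP; rewrite subn_eq0 (leq_trans i_n) // ltnW.
      split=> //; rewrite ltnNge select_le // -ltnNge.
      by rewrite /rank take0.
    set a := regs _ _; set D := layout _ _ _ _.
    have iN : 0 < i <= n by rewrite i_gt0.
    have mW : eval (w n) D a main_select < 2 ^ w n by apply: eval_lt; apply: regs_lt.
    have Ef : eval (w n) D a trivial_flag = false %% 2 ^ w n by apply: (@main_flag _ n0).
    rewrite (eval_cond Ef (X := 0) (Y := eval (w n) D a main_select)) ?modn_small ?expn_gt0 //.
    exact: (@main_select_correct _ n0).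
  by rewrite /regs /= modn_small.
Qed.

(** * Size of the data structure *)

(** Moving either argument by one changes the binomial by a ratio of at most [x]. With
    [x = 2 ^ alpha_of N] the two moves cost the [2 * alpha_of N] bits reserved in [redundancy]. *)
Lemma bin_rounding N M N' M' x : 0 < x -> N <= x ->
    N' <= N <= N'.+1 -> M <= M' <= M.+1 -> M' <= N' ->
  'C(N, M) <= x * x * 'C(N', M').
Proof.
move=> x0 Nx /andP[N'N NN'] /andP[MM' M'M] MN.
have s1 : 'C(N, M) <= x * 'C(N', M).
  have MN' := leq_trans MM' MN.
  move: NN'; rewrite leq_eqVlt => /orP[/eqP NE|NN']; last first.
    have -> : N = N' by apply/eqP; rewrite eqn_leq N'N -ltnS NN'.
    by rewrite leq_pmull.
  have := mul_bin_down N M; rewrite {2}NE /= => h.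
  by apply: leq_trans (leq_mul Nx (leqnn _)); rewrite h leq_pmull // NE subn_gt0 ltnS.
have s2 : 'C(N', M) <= x * 'C(N', M').
  move: M'M; rewrite leq_eqVlt => /orP[/eqP ME|M'M]; last first.
    have -> : M' = M by apply/eqP; rewrite eqn_leq MM' -ltnS M'M.
    by rewrite leq_pmull.
  rewrite ME; apply: (@leq_trans (M.+1 * 'C(N', M.+1))).
    by rewrite mul_bin_left leq_pmull // subn_gt0 -ME.
  by rewrite leq_mul // -ME (leq_trans MN) // (leq_trans N'N).
by apply: leq_trans s1 _; rewrite -mulnA leq_mul2l s2 orbT.
Qed.

Lemma cellsE n d : 0 < n -> 0 < d -> cells n d = (n + d.-1) %/ d.
Proof.
move=> n0 d0; have -> : n + d.-1 = n.-1 + d by lia.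
by rewrite divnDr // divnn d0.
Qed.

Lemma rounding_cells n d N : 0 < n -> 0 < d -> rounding n d N -> N <= cells n d <= N.+1.
Proof.
move=> n0 d0; rewrite /rounding -cellsE // => [[]] ->; last by rewrite leqnn leqnSn.
apply/andP; split; last by rewrite /cells addn1 ltnS leq_div2r // leq_pred.
by rewrite cellsE // leq_div2r // leq_addr.
Qed.

Lemma rounding_floor m d M : 0 < d -> rounding m d M -> m %/ d <= M <= (m %/ d).+1.
Proof.
move=> d0 [] ->; first by rewrite leqnn leqnSn.
apply/andP; split; first by rewrite leq_div2r // leq_addr.
apply: (@leq_trans ((m + d) %/ d)); first by rewrite leq_div2r // leq_add2l leq_pred.
by rewrite divnDr // divnn d0 addn1.
Qed.

Lemma size_encoding w n0 : exists c, forall n d (B : n.-tuple bool) N M,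
    0 < n -> 0 < d -> rounding n d N -> rounding (count_mem true B) d M -> M <= N ->
  2 ^ size (encoding w n0 d B) <= 2 ^ (redundancy (cells n d) + c) * 'C(N, M).
Proof.
(* The constant covers the one-bit string used for [n < d] and the full tables of all lengths below
   [n0]. *)
exists (maxn 1 (\max_(k < n0) k.+1 * w k)) => n d B N M n_gt0 d_gt0 rN rM MN.
have C0 : 0 < 'C(N, M) by rewrite bin_gt0.
have const s c : s <= c -> 2 ^ s <= 2 ^ (redundancy (cells n d) + c) * 'C(N, M).
  move=> sc; apply: leq_trans (leq_pmulr _ C0); rewrite leq_exp2l //.
  by rewrite (leq_trans sc) // leq_addl.
rewrite /encoding; case: (ltnP n n0) => nn.
  apply: const; rewrite size_bits_array leq_max; apply/orP; right.
  exact: (leq_bigmax_cond (Ordinal nn)).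
case: (ltnP n d) => nd; first by apply: const; rewrite leq_maxl.
set R := cells n d; have cov : size B <= R * d by rewrite size_tuple cells_cover.
have l0 : 0 < blk (tau_of R) by rewrite muln_gt0 expn_gt0.
rewrite size_layout expnD.
apply: (@leq_trans (2 ^ redundancy R * 'C(N, M))); last first.
  by rewrite leq_mul2r leq_exp2l // leq_addr orbT.
rewrite /redundancy -addnA expnD -mulnA leq_mul2l; apply/orP; right.
apply: leq_trans (offset_binomial _ (crossing_oversize cov) l0) _.
rewrite [X in _ <= X * _]expnD -mulnA leq_mul2l; apply/orP; right.
rewrite (crossing_ones d_gt0 cov) mul2n -addnn expnD.
apply: bin_rounding => //; rewrite ?expn_gt0 //.
- exact: ltnW (ltn_alpha_of R).
- exact: rounding_cells.
- exact: rounding_floor.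
Qed.

Lemma redundancy_vanishes c : exists K, forall T, exists k0, forall k, k0 <= k ->
  (redundancy k + redundancy k.+1 + c) * T <= K * k.
Proof.
have [K HK] := redundancy_le; exists (3 * K + 1) => T.
have [k1 Hk1] := tau_of_unbounded (maxn 3 T).
exists (maxn (maxn 1 k1) (c * T)) => k; rewrite !geq_max => /andP[/andP[k0 k1k] ck].
have red j : k <= j -> redundancy j * T <= K * j.
  move=> kj; have := Hk1 j (leq_trans k1k kj); rewrite geq_max => /andP[t3 tT].
  apply: leq_trans (HK j (leq_trans k0 kj) t3).
  by rewrite leq_mul2l tT orbT.
have := red _ (leqnn k); have := red _ (leqnSn k).
have : K * k.+1 <= 2 * (K * k) by rewrite mulnCA leq_mul2l; apply/orP; right; lia.
move: {red} (redundancy k) (redundancy k.+1) => x y; rewrite (mulnDl _ c) (mulnDl x y).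
have -> : (3 * K + 1) * k = 3 * (K * k) + k by lia.
move: (K * k) (K * k.+1) (x * T) (y * T) (c * T) ck => *; lia.
Qed.

(** * Passage to the reals and to Landau notation *)

Local Open Scope classical_set_scope.
Local Open Scope ring_scope.

Lemma natr_le_lg (R : realType) (s r C : nat) : (0 < C)%N -> (2 ^ s <= 2 ^ r * C)%N ->
  s%:R <= lg (C%:R : R) + r%:R.
Proof.
move=> C0 h; have ln2 : 0 < ln (2 : R) by rewrite ln_gt0 // ltr1n.
rewrite /lg -lerBlDr ler_pdivlMr // mulrBl lerBlDr.
have : ln ((2 ^ s)%:R : R) <= ln ((2 ^ r * C)%:R).
  by rewrite ler_ln ?ler_nat // posrE ltr0n ?muln_gt0 ?expn_gt0.
rewrite natrM lnM ?posrE ?ltr0n ?expn_gt0 // !natrX !lnXn // addrC.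
by rewrite !mulr_natl.
Qed.

Lemma trunc_ratio (R : realType) (n d : nat) : (0 < d)%N ->
  Num.trunc (n%:R / d%:R : R) = (n %/ d)%N.
Proof.
move=> d0; have dR : 0 < d%:R :> R by rewrite ltr0n.
apply: truncn_def; rewrite ler_pdivlMr // ltr_pdivrMr // -!natrM ler_nat ltr_nat.
by rewrite leq_trunc_div ltn_ceil.
Qed.

(** The error term may depend only on [x = n / delta], but the number of cells is the floor of [x]
    or one more; adding both redundancies covers either case. *)
Definition slack (R : realType) (c : nat) (x : R) : R :=
  (redundancy (Num.trunc x) + redundancy (Num.trunc x).+1 + c)%:R.

Lemma slack_littleo (R : realType) (c : nat) : slack c =o_ (pinfty_nbhs R) (fun x : R => x).
Proof.
have [K HK] := redundancy_vanishes c.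
apply/eqoP => eps eps0; have Ke : 0 <= K%:R / eps by rewrite divr_ge0 // ltW.
(* With [T > K / eps], a bound [K * k] on [T] times the slack gives at most [eps * k]. *)
have [k0 Hk0] := HK (Num.bound (K%:R / eps)).
have T0 := archi_boundP Ke; set T := Num.bound _ in Hk0 T0.
have TR : 0 < T%:R :> R by apply: le_lt_trans T0.
apply: filterS (nbhs_pinfty_ge (num_real (k0%:R : R))) => x kx.
have x0 : 0 <= x by apply: le_trans kx.
rewrite ger0_norm ?ler0n // ger0_norm // -(ler_pM2r TR) /slack -natrM.
apply: (@le_trans _ _ (K * Num.trunc x)%:R).
  by rewrite ler_nat Hk0 // truncn_ge_nat.
rewrite natrM mulrAC; apply: ler_pM => //.
  by rewrite mulrC -ler_pdivrMr // ltW.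
by rewrite truncn_le.
Qed.

Lemma size_encoding_le (R : realType) (w : nat -> nat) (n0 : nat) :
  exists c, forall (n d : nat) (B : n.-tuple bool) (N M : nat), (0 < n)%N -> (0 < d)%N ->
    rounding n d N -> rounding (count_mem true B) d M -> (M <= N)%N ->
  (size (encoding w n0 d B))%:R <= binentropy N M + slack c (n%:R / d%:R : R).
Proof.
have [c Hc] := size_encoding w n0; exists c => n d B N M n_gt0 d_gt0 rN rM MN.
apply: le_trans (natr_le_lg R _ (Hc n d B N M n_gt0 d_gt0 rN rM MN)) _.
  by rewrite bin_gt0.
rewrite lerD2l /slack trunc_ratio // ler_nat leq_add2r.
have /andP[h1 h2] := rounding_cells n_gt0 d_gt0 (or_introl (erefl (n %/ d)%N)).
move: h2; rewrite leq_eqVlt => /orP[/eqP->|h2]; first by rewrite leq_addl.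
have -> : cells n d = (n %/ d)%N by apply/eqP; rewrite eqn_leq h1 -ltnS h2.
by rewrite leq_addr.
Qed.

Lemma binentropy_le (R : realType) (N M : nat) : (M <= N)%N -> binentropy N M <= N%:R :> R.
Proof.
move=> MN; have ln2 : 0 < ln (2 : R) by rewrite ln_gt0 // ltr1n.
rewrite /binentropy /lg ler_pdivrMr // mulr_natl -lnXn // -natrX ler_ln ?ler_nat //.
- rewrite -[2%N]/(1 + 1)%N expnDn (bigD1 (inord M)) //= inordK ?ltnS // !exp1n !muln1.
  exact: leq_addr.
- by rewrite posrE ltr0n bin_gt0.
- by rewrite posrE ltr0n expn_gt0.
Qed.

Theorem theorem2 (R : realType) (w : nat -> nat)
    (w_fits : forall n : nat, (n < 2 ^ w n)%N)
    (w_Theta : (fun n : nat => (w n)%:R : R) =Theta_\oo (fun n : nat => lg (n%:R : R))) :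
  (exists (enc : forall n : nat, nat -> n.-tuple bool -> bitseq)
          (prank pselect : program) (T : nat) (f : R -> R),
     f =o_ (pinfty_nbhs R) (fun x : R => x) /\
     forall (n delta : nat) (B : n.-tuple bool), (0 < n)%N -> (0 < delta)%N ->
       supports (w n) prank pselect T delta B (enc n delta B) /\
       (size (enc n delta B))%:R <= n%:R / delta%:R + f (n%:R / delta%:R))
  /\
  (exists (enc : forall n : nat, nat -> n.-tuple bool -> bitseq)
          (prank pselect : program) (T : nat) (f : R -> R),
     f =o_ (pinfty_nbhs R) (fun x : R => x) /\
     forall (n delta m : nat) (B : n.-tuple bool), (0 < n)%N -> (0 < delta)%N ->
       count_mem true B = m ->
       supports (w n) prank pselect T delta B (enc n delta B) /\
       forall N M : nat, rounding n delta N -> rounding m delta M -> (M <= N)%N ->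
         (size (enc n delta B))%:R <= binentropy N M + f (n%:R / delta%:R)).
Proof.
have [n0 n0_large] := word_large w_fits.
have [c size_le] := size_encoding_le R w n0.
pose P := program_of (query_rank n0); pose Q := program_of (query_select n0).
split; exists (@encoding w n0), P, Q, (size P + size Q)%N.
(* The same encoding serves both claims. Here the entropy is bounded by the number of cells, which
   is at most [n / delta + 1]; the extra bit goes into [c.+1]. *)
- exists (slack c.+1); split; first exact: slack_littleo.
  move=> n d B n_gt0 d_gt0; split; first exact: supports_encoding.
  have dR : 0 < d%:R :> R by rewrite ltr0n.
  have rN : rounding n d (cells n d) by right; rewrite cellsE.
  have MN : (count_mem true B %/ d <= cells n d)%N.
    rewrite cellsE // leq_div2r // (leq_trans _ (leq_addr _ _)) //.
    by rewrite (leq_trans (count_size _ _)) ?size_tuple.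
  apply: le_trans (size_le n d B _ _ n_gt0 d_gt0 rN (or_introl (erefl _)) MN) _.
  have -> : slack c.+1 (n%:R / d%:R : R) = 1 + slack c (n%:R / d%:R).
    by rewrite /slack addnS -natr1 addrC.
  rewrite addrA lerD2r; apply: le_trans (binentropy_le R MN) _.
  rewrite /cells addn1 -natr1 lerD2r.
  rewrite ler_pdivlMr // -natrM ler_nat (leq_trans (leq_trunc_div _ _)) //.
  exact: leq_pred.
- exists (slack c); split; first exact: slack_littleo.
  move=> n d m B n_gt0 d_gt0 <-; split; first exact: supports_encoding.
  by move=> N M rN rM MN; apply: size_le.
Qed.
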